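(* Let $T$ be a complete first order theory with countable signature and models of cardinality $>1$, and suppose $T$ has $\operatorname{acl}=\operatorname{dcl}$. Then the algebraic independence relation $\perp^a$ in the big model $\mathcal N$ of $T^R$ has small local character: for all small $A,B,C_0\subseteq\mathcal K$ with $C_0\subseteq B$ and $|C_0|\le|A|+\aleph_0$, there is $C$ with $C_0\subseteq C\subseteq B$ and $|C|\le|A|+\aleph_0$ such that $A\perp^a_C B$.
   Context: A theory has $\operatorname{acl}=\operatorname{dcl}$ if algebraic closure equals definable closure for every set in every model of it. Fix an uncountable inaccessible cardinal $\upsilon$; small means cardinality $<\upsilon$. $\mathcal M$ is the big model of $T$ (saturated, finite or of cardinality $\upsilon$). $T^R$ (the randomization of $T$) is the complete continuous theory in the two-sorted signature with a sort $\mathbb K$ (random elements) and a sort $\mathbb B$ (events), a function symbol $[\![\varphi(\cdot)]\!]$ of sort $\mathbb K^n\to\mathbb B$ for each first order formula $\varphi$ with $n$ free variables, a $[0,1]$-valued predicate $\mu$ on $\mathbb B$, Boolean operations on $\mathbb B$, and metrics $d_{\mathbb K},d_{\mathbb B}$; its big model $\mathcal N=(\mathcal K,\mathcal E)$ (saturated, cardinality $\upsilon$) is the reduction of a pre-structure of functions $\Omega\to M$ and events over a complete atomless probability space $(\Omega,\mathcal F,\mu)$, with $[\![\psi(\vec a)]\!]=\{\omega:\mathcal M\models\psi(\vec a(\omega))\}$, $\mathcal F$ consisting exactly of such events, the fullness property that for each $\theta(u,\vec v)$ and $\vec b$ some $a$ has $[\![\theta(a,\vec b)]\!]=[\![\exists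 u\,\theta(u,\vec b)]\!]$, $d_{\mathbb K}(a,b)=\mu[\![a\ne b]\!]$, $d_{\mathbb B}(\mathsf B,\mathsf C)=\mu(\mathsf B\triangle\mathsf C)$. For small $A,B,C\subseteq\mathcal K$, $A\perp^a_C B$ means $\operatorname{acl}(AC)\cap\operatorname{acl}(BC)=\operatorname{acl}(C)$ and $\operatorname{acl}_{\mathbb B}(AC)\cap\operatorname{acl}_{\mathbb B}(BC)=\operatorname{acl}_{\mathbb B}(C)$, where $\operatorname{acl}$, $\operatorname{acl}_{\mathbb B}$ are the sets of elements of sort $\mathbb K$, resp. $\mathbb B$, algebraic over the given set in $\mathcal N$ (continuous logic); $AC=A\cup C$. *)

(* Defs.v *)
From HB Require Import structures.
From mathcomp Require Import all_boot all_order all_algebra.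
From mathcomp Require Import all_classical all_reals all_analysis.

Set Implicit Arguments.
Unset Strict Implicit.
Unset Printing Implicit Defensive.

Import Order.TTheory GRing.Theory Num.Theory.
Import numFieldNormedType.Exports.

Local Open Scope classical_set_scope.
Local Open Scope card_scope.
Local Open Scope ring_scope.

Definition card_lt (X Y : Type) (A : set X) (B : set Y) : Prop :=
  A #<= B /\ ~ (B #<= A).

(* A cardinal is represented by a type U of that cardinality. *)
Definition small (U X : Type) (A : set X) : Prop := card_lt A [set: U].

Definition uncountable_inaccessible (U : Type) : Prop :=
  [/\ ~ countable [set: U],
      forall A : set U, small U A -> small U [set X : set U | X `<=` A]
    & forall (I : set U) (F : U -> set U), small U I ->
        (forall i, I i -> small U (F i)) -> small U (\bigcup_(i in I) F i)].

(* A set of cardinality |A| + aleph_0. *)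
Definition plus_aleph0 (X : Type) (A : set X) : set (X + nat) :=
  [set z | if z is inl x then A x else True].

Definition nilv (X : Type) (i : 'I_0) : X := False_rect X (notF (ltn_ord i)).

Definition scons (X : Type) (n : nat) (a : X) (v : 'I_n -> X) (i : 'I_n.+1) : X :=
  if unlift ord0 i is Some j then v j else a.

Definition fcat (X : Type) (m n : nat) (v : 'I_m -> X) (w : 'I_n -> X)
    (i : 'I_(m + n)) : X :=
  match fintype.split i with inl j => v j | inr k => w k end.

Record language := Language {
  fsym : Type;
  far : fsym -> nat;
  rsym : Type;
  rar : rsym -> nat
}.

Definition countable_language (L : language) : Prop :=
  countable [set: fsym L] /\ countable [set: rsym L].

Inductive term (L : language) (n : nat) : Type :=
| Var (i : 'I_n)
| App (f : fsym L) (ts : 'I_(far f) -> term L n).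

Arguments Var L {n} i.

(* [form L n] is the type of formulas phi(x_0, ..., x_{n-1}); [FEx] binds the
   variable 0 and the other variables are shifted by one. The remaining
   connectives and the universal quantifier are abbreviations. *)
Inductive form (L : language) (n : nat) : Type :=
| FEq (s t : term L n)
| FRel (r : rsym L) (ts : 'I_(rar r) -> term L n)
| FNot (phi : form L n)
| FAnd (phi psi : form L n)
| FEx (phi : form L n.+1).

Fixpoint tren (L : language) (m n : nat) (s : 'I_m -> 'I_n) (t : term L m) :
    term L n :=
  match t with
  | Var i => Var L (s i)
  | App f ts => App (fun i => tren s (ts i))
  end.

Fixpoint fren (L : language) (m n : nat) (s : 'I_m -> 'I_n) (phi : form L m)
    {struct phi} : form L n :=
  match phi with
  | FEq t u => FEq (tren s t) (tren s u)
  | FRel r ts => FRel (fun i => tren s (ts i))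
  | FNot phi => FNot (fren s phi)
  | FAnd phi psi => FAnd (fren s phi) (fren s psi)
  | FEx phi => FEx (fren (scons ord0 (fun i => lift ord0 (s i))) phi)
  end.

Record structure (L : language) := Structure {
  dom :> Type;
  dom_inhabited : inhabited dom;
  fint : forall f : fsym L, ('I_(far f) -> dom) -> dom;
  rint : forall r : rsym L, ('I_(rar r) -> dom) -> Prop
}.

Fixpoint teval (L : language) (M : structure L) (n : nat) (v : 'I_n -> M)
    (t : term L n) : M :=
  match t with
  | Var i => v i
  | App f ts => fint (fun i => teval v (ts i))
  end.

Fixpoint sat (L : language) (M : structure L) (n : nat) (phi : form L n) :
    ('I_n -> M) -> Prop :=
  match phi with
  | FEq s t => fun v => teval v s = teval v t
  | FRel r ts => fun v => rint (fun i => teval v (ts i))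
  | FNot phi => fun v => ~ sat phi v
  | FAnd phi psi => fun v => sat phi v /\ sat psi v
  | FEx phi => fun v => exists a : M, sat phi (scons a v)
  end.

Definition valid (L : language) (n : nat) (phi : form L n) : Prop :=
  forall (M : structure L) (v : 'I_n -> M), sat phi v.

Definition theory (L : language) := set (form L 0).

Definition models (L : language) (M : structure L) (T : theory L) : Prop :=
  forall phi, T phi -> sat phi (@nilv M).

Definition entails (L : language) (T : theory L) (phi : form L 0) : Prop :=
  forall M : structure L, models M T -> sat phi (@nilv M).

Definition complete_theory (L : language) (T : theory L) : Prop :=
  (exists M : structure L, models M T) /\
  forall phi, entails T phi \/ entails T (FNot phi).

(* The first [k] variables are free, the other ones stand for parameters. *)
Record pform (L : language) (X : Type) (k : nat) := PForm {
  pf_n : nat;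
  pf_form : form L (k + pf_n);
  pf_par : 'I_pf_n -> X
}.

Arguments pf_par {L X k} p i.

Definition pf_over (L : language) (X : Type) (k : nat) (A : set X)
    (phi : pform L X k) : Prop :=
  forall i, A (pf_par phi i).

Definition psat (L : language) (M : structure L) (k : nat) (phi : pform L M k)
    (v : 'I_k -> M) : Prop :=
  sat (pf_form phi) (fcat v (pf_par phi)).

Definition fo_defset (L : language) (M : structure L) (phi : pform L M 1) :
    set M :=
  [set x | psat phi (fun=> x)].

Definition fo_acl (L : language) (M : structure L) (A : set M) : set M :=
  [set b | exists phi : pform L M 1,
    [/\ pf_over A phi, fo_defset phi b & finite_set (fo_defset phi)]].

Definition fo_dcl (L : language) (M : structure L) (A : set M) : set M :=
  [set b | exists2 phi : pform L M 1, pf_over A phi & fo_defset phi = [set b]].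

Definition has_acl_eq_dcl (L : language) (T : theory L) : Prop :=
  forall M : structure L, models M T -> forall A : set M, fo_acl A = fo_dcl A.

Definition fo_saturated (L : language) (M : structure L) : Prop :=
  forall A : set M, card_lt A [set: M] ->
  forall p : set (pform L M 1), p `<=` pf_over A ->
    (forall q : set (pform L M 1), finite_set q -> q `<=` p ->
       exists b : M, forall phi, q phi -> fo_defset phi b) ->
    exists b : M, forall phi, p phi -> fo_defset phi b.

Definition big_model (U : Type) (L : language) (T : theory L)
    (M : structure L) : Prop :=
  [/\ models M T, fo_saturated M
    & finite_set [set: M] \/ [set: M] #= [set: U]].

Record rstructure (L : language) (R : realType) := RStructure {
  KS : metricType R;
  BS : metricType R;
  ev : forall n : nat, form L n -> ('I_n -> KS) -> BS;
  rmu : BS -> R;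
  btop : BS;
  bbot : BS;
  bmeet : BS -> BS -> BS;
  bjoin : BS -> BS -> BS;
  bcompl : BS -> BS
}.

Definition complete_metric (R : realType) (X : metricType R) : Prop :=
  forall F : set_system X, ProperFilter F -> cauchy F ->
    exists l : X, F --> l.

(* The symbols of the signature are 1-Lipschitz in each argument. *)
Record is_metric_structure (L : language) (R : realType)
    (N : rstructure L R) : Prop := {
  ms_completeK : complete_metric (KS N);
  ms_completeB : complete_metric (BS N);
  ms_diamK : forall a b : KS N, mdist a b <= 1;
  ms_diamB : forall B C : BS N, mdist B C <= 1;
  ms_mu_bnd : forall B : BS N, 0 <= rmu B <= 1;
  ms_mu : forall B C : BS N, `|rmu B - rmu C| <= mdist B C;
  ms_ev : forall (n : nat) (phi : form L n) (a b : 'I_n -> KS N),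
    mdist (ev phi a) (ev phi b) <= \sum_(i < n) mdist (a i) (b i);
  ms_meet : forall B C B' C' : BS N,
    mdist (bmeet B C) (bmeet B' C') <= mdist B B' + mdist C C';
  ms_join : forall B C B' C' : BS N,
    mdist (bjoin B C) (bjoin B' C') <= mdist B B' + mdist C C';
  ms_compl : forall B C : BS N, mdist (bcompl B) (bcompl C) <= mdist B C
}.

(* Terms of sort B in [m] variables of sort K and [n] variables of sort B; the
   only terms of sort K are variables. *)
Inductive bterm (L : language) (m n : nat) : Type :=
| BVar (j : 'I_n)
| BEv (k : nat) (phi : form L k) (s : 'I_k -> 'I_m)
| BTop
| BBot
| BMeet (s t : bterm L m n)
| BJoin (s t : bterm L m n)
| BCompl (s : bterm L m n).

Definition cube (R : realType) (k : nat) : set 'rV[R]_k :=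
  [set x | forall i, 0 <= x 0 i <= 1].

Record connective (R : realType) (k : nat) := Connective {
  conn :> 'rV[R]_k -> R;
  conn_continuous : {within @cube R k, continuous conn};
  conn_bnd : forall x, @cube R k x -> 0 <= conn x <= 1
}.

Inductive cform (L : language) (R : realType) (m n : nat) : Type :=
| CMu (s : bterm L m n)
| CDistK (i j : 'I_m)
| CDistB (s t : bterm L m n)
| CConn (k : nat) (u : connective R k) (phi : 'I_k -> cform L R m n)
| CSupK (phi : cform L R m.+1 n)
| CInfK (phi : cform L R m.+1 n)
| CSupB (phi : cform L R m n.+1)
| CInfB (phi : cform L R m n.+1).

Fixpoint bval (L : language) (R : realType) (N : rstructure L R) (m n : nat)
    (x : 'I_m -> KS N) (y : 'I_n -> BS N) (t : bterm L m n) : BS N :=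
  match t with
  | BVar j => y j
  | BEv k phi s => ev phi (fun i => x (s i))
  | BTop => btop N
  | BBot => bbot N
  | BMeet s t => bmeet (bval x y s) (bval x y t)
  | BJoin s t => bjoin (bval x y s) (bval x y t)
  | BCompl s => bcompl (bval x y s)
  end.

Fixpoint cval (L : language) (R : realType) (N : rstructure L R) (m n : nat)
    (phi : cform L R m n) : ('I_m -> KS N) -> ('I_n -> BS N) -> R :=
  match phi with
  | CMu s => fun x y => rmu (bval x y s)
  | CDistK i j => fun x _ => mdist (x i) (x j)
  | CDistB s t => fun x y => mdist (bval x y s) (bval x y t)
  | CConn k u phi => fun x y => u (\row_(i < k) cval (phi i) x y)
  | CSupK phi => fun x y => sup (range (fun a : KS N => cval phi (scons a x) y))
  | CInfK phi => fun x y => inf (range (fun a : KS N => cval phi (scons a x) y))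
  | CSupB phi => fun x y => sup (range (fun B : BS N => cval phi x (scons B y)))
  | CInfB phi => fun x y => inf (range (fun B : BS N => cval phi x (scons B y)))
  end.

(* The first [m] variables of sort K and the first [n] variables of sort B are
   free, the other ones stand for parameters. *)
Record pcform (L : language) (R : realType) (N : rstructure L R)
    (m n : nat) := PCForm {
  pc_m : nat;
  pc_n : nat;
  pc_form : cform L R (m + pc_m) (n + pc_n);
  pc_parK : 'I_pc_m -> KS N;
  pc_parB : 'I_pc_n -> BS N
}.

Arguments pc_parK {L R N m n} p i.
Arguments pc_parB {L R N m n} p i.

Definition pc_over (L : language) (R : realType) (N : rstructure L R)
    (m n : nat) (A : set (KS N)) (E : set (BS N)) (phi : pcform N m n) : Prop :=
  (forall i, A (pc_parK phi i)) /\ (forall j, E (pc_parB phi j)).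

Definition pcval (L : language) (R : realType) (N : rstructure L R)
    (m n : nat) (phi : pcform N m n) (x : 'I_m -> KS N) (y : 'I_n -> BS N) : R :=
  cval (pc_form phi) (fcat x (pc_parK phi)) (fcat y (pc_parB phi)).

(* Each formula [phi] of a type stands for the condition [phi = 0]. *)
Definition csaturated (L : language) (R : realType) (N : rstructure L R) :
    Prop :=
  forall (A : set (KS N)) (E : set (BS N)),
  card_lt A [set: KS N + BS N] -> card_lt E [set: KS N + BS N] ->
  forall (m n : nat) (p : set (pcform N m n)), p `<=` pc_over A E ->
    (forall q : set (pcform N m n), finite_set q -> q `<=` p ->
       exists x y, forall phi, q phi -> pcval phi x y = 0) ->
    exists x y, forall phi, p phi -> pcval phi x y = 0.

(* Predicates that are uniform limits of formulas over [A], [A] being a set of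
   elements of sort K. *)
Definition definable_pred (L : language) (R : realType) (N : rstructure L R)
    (A : set (KS N)) (m n : nat)
    (P : ('I_m -> KS N) -> ('I_n -> BS N) -> R) : Prop :=
  exists2 phi : nat -> pcform N m n,
    forall k, pc_over A set0 (phi k)
  & forall e : R, 0 < e -> exists k0 : nat, forall k : nat, (k0 <= k)%N ->
      forall x y, `|pcval (phi k) x y - P x y| <= e.

Definition dist_to (R : realType) (X : metricType R) (C : set X) (x : X) : R :=
  inf [set mdist x c | c in C].

(* A closed set is definable over [A] when the distance to it is a definable
   predicate; an element is algebraic when it lies in a compact definable
   set. *)
Definition aclK (L : language) (R : realType) (N : rstructure L R)
    (A : set (KS N)) : set (KS N) :=
  [set b | exists C : set (KS N),
    [/\ compact C, C b
      & @definable_pred L R N A 1 0 (fun x _ => dist_to C (x ord0))]].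

Definition aclB (L : language) (R : realType) (N : rstructure L R)
    (A : set (KS N)) : set (BS N) :=
  [set B | exists C : set (BS N),
    [/\ compact C, C B
      & @definable_pred L R N A 0 1 (fun _ y => dist_to C (y ord0))]].

Definition bsymdiff (L : language) (R : realType) (N : rstructure L R)
    (B C : BS N) : BS N :=
  bjoin (bmeet B (bcompl C)) (bmeet (bcompl B) C).

Definition eq01 (L : language) : form L 2 :=
  FEq (Var L ord0) (Var L ord_max).

Definition pairv (X : Type) (a b : X) : 'I_2 -> X := scons a (scons b (@nilv X)).

(* The Ben Yaacov-Keisler axioms. In continuous logic [exists x (s = t)] is the
   condition [inf_x d(s, t) = 0], whence the [e] below. The axiom [tr_ren] is
   needed because a formula comes here with its list of variables, so that for
   instance a formula and the same formula with a dummy variable are different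
   symbols. *)
Record models_TR (L : language) (R : realType) (T : theory L)
    (N : rstructure L R) : Prop := {
  tr_metric : is_metric_structure N;
  tr_valid : forall (n : nat) (phi : form L n) (a : 'I_n -> KS N),
    valid phi -> ev phi a = btop N;
  tr_ren : forall (m n : nat) (s : 'I_m -> 'I_n) (phi : form L m)
    (a : 'I_n -> KS N), ev (fren s phi) a = ev phi (fun i => a (s i));
  tr_meetC : forall B C : BS N, bmeet B C = bmeet C B;
  tr_joinC : forall B C : BS N, bjoin B C = bjoin C B;
  tr_meetA : forall B C D : BS N, bmeet B (bmeet C D) = bmeet (bmeet B C) D;
  tr_joinA : forall B C D : BS N, bjoin B (bjoin C D) = bjoin (bjoin B C) D;
  tr_meetKU : forall B C : BS N, bmeet B (bjoin B C) = B;
  tr_joinKI : forall B C : BS N, bjoin B (bmeet B C) = B;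
  tr_meetUr : forall B C D : BS N,
    bmeet B (bjoin C D) = bjoin (bmeet B C) (bmeet B D);
  tr_meetT : forall B : BS N, bmeet B (btop N) = B;
  tr_join0 : forall B : BS N, bjoin B (bbot N) = B;
  tr_meetN : forall B : BS N, bmeet B (bcompl B) = bbot N;
  tr_joinN : forall B : BS N, bjoin B (bcompl B) = btop N;
  tr_not : forall (n : nat) (phi : form L n) (a : 'I_n -> KS N),
    ev (FNot phi) a = bcompl (ev phi a);
  tr_and : forall (n : nat) (phi psi : form L n) (a : 'I_n -> KS N),
    ev (FAnd phi psi) a = bmeet (ev phi a) (ev psi a);
  tr_distK : forall a b : KS N, mdist a b = 1 - rmu (ev (eq01 L) (pairv a b));
  tr_distB : forall B C : BS N, mdist B C = rmu (bsymdiff B C);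
  tr_full : forall (n : nat) (theta : form L n.+1) (b : 'I_n -> KS N) (e : R),
    0 < e -> exists a : KS N,
      mdist (ev theta (scons a b)) (ev (FEx theta) b) < e;
  tr_event : forall (B : BS N) (e : R), 0 < e ->
    exists a b : KS N, mdist B (ev (eq01 L) (pairv a b)) < e;
  tr_mu_top : rmu (btop N) = 1;
  tr_mu_bot : rmu (bbot N) = 0;
  tr_mu_add : forall B C : BS N,
    rmu B + rmu C = rmu (bjoin B C) + rmu (bmeet B C);
  tr_atomless : forall (B : BS N) (e : R), 0 < e ->
    exists C : BS N, `|rmu (bmeet B C) - rmu B / 2| < e;
  tr_transfer : forall phi : form L 0, T phi -> ev phi (@nilv (KS N)) = btop N
}.

Definition big_model_TR (U : Type) (L : language) (R : realType)
    (T : theory L) (N : rstructure L R) : Prop :=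
  [/\ models_TR T N, csaturated N & [set: KS N + BS N] #= [set: U]].

Definition atomless (d : measure_display) (Omega : measurableType d)
    (R : realType) (P : probability Omega R) : Prop :=
  forall A : set Omega, measurable A -> (0 < P A)%E ->
    exists B : set Omega,
      [/\ measurable B, B `<=` A, (0 < P B)%E & (P B < P A)%E].

Definition event (L : language) (M : structure L) (Omega : Type) (n : nat)
    (phi : form L n) (a : 'I_n -> Omega -> M) : set Omega :=
  [set w | sat phi (fun i => a i w)].

Record is_prestructure (L : language) (M : structure L) (d : measure_display)
    (Omega : measurableType d) (R : realType) (P : probability Omega R)
    (K : set (Omega -> M)) : Prop := {
  ps_complete : measure_is_complete P;
  ps_atomless : atomless P;
  ps_meas : forall (n : nat) (phi : form L n) (a : 'I_n -> Omega -> M),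
    (forall i, K (a i)) -> measurable (event phi a);
  ps_event : forall B : set Omega, measurable B ->
    exists (n : nat) (phi : form L n) (a : 'I_n -> Omega -> M),
      (forall i, K (a i)) /\ B = event phi a;
  ps_full : forall (n : nat) (theta : form L n.+1) (b : 'I_n -> Omega -> M),
    (forall i, K (b i)) ->
    exists2 a, K a & event theta (scons a b) = event (FEx theta) b
}.

(* The quotient maps [qK] and [qB] are relevant only on [K] and on the
   measurable sets. They identify exactly the elements at distance 0, because
   the metrics of [N] are genuine metrics. *)
Record is_quotient (L : language) (M : structure L) (d : measure_display)
    (Omega : measurableType d) (R : realType) (P : probability Omega R)
    (K : set (Omega -> M)) (N : rstructure L R)
    (qK : (Omega -> M) -> KS N) (qB : set Omega -> BS N) : Prop := {
  q_surjK : forall x : KS N, exists2 a, K a & qK a = x;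
  q_surjB : forall y : BS N, exists2 B, measurable B & qB B = y;
  q_distK : forall a b, K a -> K b ->
    (mdist (qK a) (qK b))%:E = P [set w | a w <> b w];
  q_distB : forall B C, measurable B -> measurable C ->
    (mdist (qB B) (qB C))%:E = P ((B `\` C) `|` (C `\` B));
  q_ev : forall (n : nat) (phi : form L n) (a : 'I_n -> Omega -> M),
    (forall i, K (a i)) -> ev phi (fun i => qK (a i)) = qB (event phi a);
  q_mu : forall B, measurable B -> (rmu (qB B))%:E = P B;
  q_top : btop N = qB setT;
  q_bot : bbot N = qB set0;
  q_meet : forall B C, measurable B -> measurable C ->
    bmeet (qB B) (qB C) = qB (B `&` C);
  q_join : forall B C, measurable B -> measurable C ->
    bjoin (qB B) (qB C) = qB (B `|` C);
  q_compl : forall B, measurable B -> bcompl (qB B) = qB (~` B)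
}.

Definition is_reduction (L : language) (M : structure L) (d : measure_display)
    (Omega : measurableType d) (R : realType) (P : probability Omega R)
    (K : set (Omega -> M)) (N : rstructure L R) : Prop :=
  exists qK qB, @is_quotient L M d Omega R P K N qK qB.

Definition alg_indep (L : language) (R : realType) (N : rstructure L R)
    (A C B : set (KS N)) : Prop :=
  aclK (A `|` C) `&` aclK (B `|` C) = aclK C /\
  aclB (A `|` C) `&` aclB (B `|` C) = aclB C.

(* [I A C B] is read: A is independent from B over C. *)
Definition small_local_character (U X : Type)
    (I : set X -> set X -> set X -> Prop) : Prop :=
  forall A B C0 : set X, small U A -> small U B -> small U C0 ->
    C0 `<=` B -> C0 #<= plus_aleph0 A ->
    exists C : set X,
      [/\ C0 `<=` C, C `<=` B, C #<= plus_aleph0 A & I A C B].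

(* Main.v *)
(* Elements of [aclB X] and [aclK X] have a concrete description: the former
   are the limits of events [phi(x)], the latter the elements that coincide, on
   events of probability arbitrarily close to 1, with the value at some tuple
   [x] of a definable partial function. For if [b] is not of this kind, a formula
   with parameters [x], whose value is controlled by the measures of finitely many
   events, does not distinguish [b] from infinitely many copies of it, drawn
   independently given the [x]-events; these are uniformly separated, and hence do
   not lie in a compact set.

   Local character is then a Loewenheim-Skolem argument. Close [C0] inside [B]
   under the following operation: whenever an event [phi(s)], or the value of a
   definable partial function, with [s] in [A] and [C], can be approximated up to
   [1/k] using parameters from [B], put such parameters in [C]. As the forms and the
   [k] are countable in number, the closure has at most [|A| + aleph_0] elements. *)

Require Import Defs.
From mathcomp Require Import all_boot all_order all_algebra.
From mathcomp Require Import all_classical all_reals all_analysis.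
From mathcomp Require Import ring lra.
Import Defs.

Set Implicit Arguments.
Unset Strict Implicit.
Unset Printing Implicit Defensive.

Import Order.TTheory GRing.Theory Num.Theory.
Import numFieldNormedType.Exports.

Local Open Scope classical_set_scope.
Local Open Scope ring_scope.

(** * Atomless probability spaces *)

Section Probability.
Context (d : measure_display) (Om : measurableType d) (R : realType).
Variable P : probability Om R.

(** Formulas are controlled by finitely many measures through a back-and-forth that matches laws
    rather than points: a new element or event matters only through the finite truth pattern it
    produces pointwise, atomlessness realizes any prescribed conditional law of patterns, and
    fullness provides witnesses of the patterns, which are glued. The copies of [b] must be far
    apart besides having the right law. Two conditionally independent draws agree with probability
    at most that of the best guess of the draw from the [x]-events; for an event such a guess is
    itself an event over [x], hence wrong with probability at least [e]. For an element the pattern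
    is not enough, since two copies with the same pattern may be equal. A pattern with a single
    realization is the graph of a definable partial function; for the others a fair bit chooses
    between two distinct realizations, which halves the separation. *)

Definition prob (A : set Om) : R := fine (P A).

Lemma prE A : measurable A -> (prob A)%:E = P A.
Proof. by move=> mA; rewrite /prob fineK// fin_num_measure. Qed.

Lemma pr_ge0 A : 0 <= prob A.
Proof. exact/fine_ge0/measure_ge0. Qed.

Lemma prS A B : measurable A -> measurable B -> A `<=` B -> prob A <= prob B.
Proof.
by move=> mA mB AB; rewrite -lee_fin !prE// le_measure// ?inE.
Qed.

Lemma prT : prob setT = 1.
Proof. by rewrite /prob probability_setT. Qed.

Lemma pr0 : prob set0 = 0.
Proof. by rewrite /prob measure0. Qed.

Lemma pr_le1 A : measurable A -> prob A <= 1.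
Proof. by move=> mA; rewrite -prT; apply: prS. Qed.

Lemma prU A B : measurable A -> measurable B -> A `&` B = set0 ->
  prob (A `|` B) = prob A + prob B.
Proof.
move=> mA mB AB; apply: EFin_inj; rewrite EFinD !prE//; last exact: measurableU.
exact: measureU.
Qed.

Lemma prD A B : measurable A -> measurable B -> B `<=` A ->
  prob (A `\` B) = prob A - prob B.
Proof.
move=> mA mB BA; rewrite -{2}(setDUK BA) prU//; first by ring.
- exact: measurableD.
- by rewrite setDIK.
Qed.

Lemma prU_le A B : measurable A -> measurable B -> prob (A `|` B) <= prob A + prob B.
Proof.
move=> mA mB; rewrite -lee_fin EFinD !prE//; last exact: measurableU.
exact: measureU2.
Qed.

Lemma pr_eq_off_null (A B E : set Om) :
  measurable A -> measurable B -> measurable E -> prob E = 0 ->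
  (forall w, ~ E w -> (A w <-> B w)) -> prob A = prob B.
Proof.
suff H (A' B' : set Om) : measurable A' -> measurable B' -> measurable E ->
    prob E = 0 -> (forall w, ~ E w -> (A' w -> B' w)) -> prob A' <= prob B'.
  move=> mA mB mE E0 h; apply/eqP; rewrite eq_le !H// => w /h[].
    by move=> _; exact.
  by move=> + _; exact.
move=> mA mB mE E0 h; rewrite -[leRHS]addr0 -E0.
apply: le_trans (prU_le mB mE); apply: prS => //; first exact: measurableU.
move=> w Aw; have [Ew|nEw] := pselect (E w); first by right.
by left; exact: h.
Qed.

(** Meant for finite [G], where measurable fibres make every preimage measurable. *)
Definition fmeas (G : Type) (g : Om -> G) :=
  forall x, measurable (g @^-1` [set x]).

Lemma fmeas_set (G : finType) (g : Om -> G) (D : set G) :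
  fmeas g -> measurable (g @^-1` D).
Proof.
move=> mg; rewrite (_ : g @^-1` D = \bigcup_(x in D) g @^-1` [set x]).
  by apply: fin_bigcup_measurable; [exact: finite_finset|move=> x _; exact: mg].
apply/seteqP; split => [w Dw|w [x Dx /= ->]//].
by exists (g w).
Qed.

Lemma fmeas_comp (G H : finType) (g : Om -> G) (h : G -> H) :
  fmeas g -> fmeas (h \o g).
Proof. by move=> mg x; exact: (fmeas_set (h @^-1` [set x]) mg). Qed.

Lemma fmeas_pair (G H : finType) (g : Om -> G) (h : Om -> H) :
  fmeas g -> fmeas h -> fmeas (fun w => (g w, h w)).
Proof.
move=> mg mh [x y].
rewrite (_ : _ @^-1` _ = g @^-1` [set x] `&` h @^-1` [set y]).
  exact: measurableI.
by apply/seteqP; split => w /= [-> ->].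
Qed.

Lemma fmeas_ffun (J H : finType) (g : J -> Om -> H) :
  (forall j, fmeas (g j)) -> fmeas (fun w => [ffun j => g j w]).
Proof.
move=> mg x; rewrite (_ : _ @^-1` _ = \bigcap_(j in setT) g j @^-1` [set x j]).
  by apply: fin_bigcap_measurable => // j _; exact: mg.
apply/seteqP; split => w /=; first by move=> <- j _ /=; rewrite ffunE.
by move=> h; apply/ffunP => j; rewrite ffunE; exact: h.
Qed.

Lemma fmeas_bool (A : set Om) : measurable A -> fmeas (fun w => `[< A w >]).
Proof.
move=> mA [].
  by rewrite (_ : _ @^-1` _ = A)//; apply/seteqP; split => w /asboolP.
rewrite (_ : _ @^-1` _ = ~` A); first exact: measurableC.
apply/seteqP; split => w /=; first by move=> /negbT/asboolPn.
by move=> nA; apply/negbTE/asboolPn.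
Qed.

Lemma pr_sum (G : finType) (g : Om -> G) (A : set Om) :
  fmeas g -> measurable A -> prob A = \sum_x prob (A `&` g @^-1` [set x]).
Proof.
move=> mg mA.
have H (l : seq G) : uniq l ->
    prob (A `&` [set w | g w \in l]) = \sum_(x <- l) prob (A `&` g @^-1` [set x]).
  elim: l => [_|x l ih /= /andP[xl ul]].
    by rewrite big_nil -pr0; congr prob; apply/seteqP; split => w [].
  rewrite big_cons -(ih ul) -prU//.
  - congr prob; apply/seteqP; split => w /=.
      by rewrite inE => -[Aw /orP[/eqP|]]; [left|right].
    by move=> [[Aw ->]|[Aw h]]; split => //; rewrite inE ?eqxx ?h ?orbT.
  - by apply: measurableI => //; exact: mg.
  - by apply: measurableI => //; exact: (fmeas_set [set x | x \in l] mg).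
  - apply/seteqP; split => w //= [[_ gx] [_ h]].
    by rewrite gx (negbTE xl) in h.
rewrite -(H (index_enum G)) ?index_enum_uniq//; congr prob.
by apply/seteqP; split => w /=; [|by case] => Aw; split => //; rewrite mem_index_enum.
Qed.

Lemma pr_sum_in (G : finType) (g : Om -> G) (D : {pred G}) :
  fmeas g -> prob [set w | g w \in D] = \sum_(x in D) prob (g @^-1` [set x]).
Proof.
move=> mg; rewrite (pr_sum mg); last exact: (fmeas_set [set x | x \in D] mg).
rewrite [RHS]big_mkcond; apply: eq_bigr => x _; case: ifPn => xD.
  by congr prob; apply/seteqP; split => w /=; [by case|] => gx; split => //; rewrite gx.
rewrite -pr0; congr prob; apply/seteqP; split => w //= [h gx].
by rewrite gx (negbTE xD) in h.
Qed.

Lemma pr_same_law (G : finType) (g h : Om -> G) (D : {pred G}) :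
  fmeas g -> fmeas h ->
  (forall x, prob (g @^-1` [set x]) = prob (h @^-1` [set x])) ->
  prob [set w | g w \in D] = prob [set w | h w \in D].
Proof.
by move=> mg mh e; rewrite !pr_sum_in//; apply: eq_bigr => x _; exact: e.
Qed.

(** * Sets and finite-valued maps of prescribed law in an atomless space *)

Section Sierpinski.
Hypothesis atl : atomless P.

(** Of a part of [A] of intermediate measure and its complement in [A], one has at most half the
    measure of [A]. *)
Lemma atomless_half A : measurable A -> 0 < prob A ->
  exists B, [/\ measurable B, B `<=` A, 0 < prob B & prob B <= prob A / 2].
Proof.
move=> mA A0.
have [|B [mB BA B0 BltA]] := atl mA; first by rewrite -prE// lte_fin.
move: B0 BltA; rewrite -!prE// !lte_fin => B0 BltA.
have [h|h] := leP (prob B) (prob A / 2); first by exists B.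
have mD : measurable (A `\` B) by exact: measurableD.
have := prD mA mB BA => e.
by exists (A `\` B); split; [exact: mD|exact: subDsetl|rewrite e; lra|rewrite e; lra].
Qed.

Lemma atomless_small A e : measurable A -> 0 < prob A -> 0 < e ->
  exists B, [/\ measurable B, B `<=` A, 0 < prob B & prob B <= e].
Proof.
move=> mA A0 e0.
have H n : exists B, [/\ measurable B, B `<=` A, 0 < prob B & prob B <= 2^-1 ^+ n].
  elim: n => [|n [B [mB BA B0 Bn]]].
    by exists A; split => //; rewrite expr0 pr_le1.
  have [B' [mB' BB' B'0 le]] := atomless_half mB B0.
  exists B'; split => //; first exact: subset_trans BA.
  by rewrite exprS; apply: (le_trans le); lra.
have c : (2^-1 : R) ^+ n @[n --> \oo] --> (0 : R).
  by apply: cvg_expr; rewrite ger0_norm// invf_lt1// ltr1n.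
have /cvgrPdist_le /(_ e e0)[n _ /(_ n (leqnn n))] := c.
rewrite sub0r normrN ger0_norm ?exprn_ge0// => le.
have [B [mB BA B0 Bn]] := H n.
by exists B; split => //; exact: le_trans le.
Qed.

(* A maximal subset of measure at most [t], reached by a greedy increasing
   sequence, has measure [t], since a small piece could be added otherwise. *)
Lemma atomless_ivt A t : measurable A -> 0 <= t <= prob A ->
  exists B, [/\ measurable B, B `<=` A & prob B = t].
Proof.
move=> mA /andP[t0 tA].
pose good B := [/\ measurable B, B `<=` A & prob B <= t].
pose above B := [set x | exists D, [/\ good D, B `<=` D & x = prob D]].
have gsup B : good B -> has_sup (above B).
  move=> gB; split; first by exists (prob B), B; split.
  by exists t => _ [D [[_ _ ?] _ ->]].
(* [next] asks for at least half of the gain in measure still possible above [B], because the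
   supremum need not be attained. *)
pose next (B C : set Om) := good B ->
  [/\ good C, B `<=` C & forall D, good D -> B `<=` D ->
      prob D - prob B <= 2 * (prob C - prob B)].
have /choice[f fP] : forall B, exists C, next B C.
  move=> B; rewrite /next; have [gB|nB] := pselect (good B); last by exists B.
  pose s := sup (above B); have hs := gsup B gB.
  have le D : good D -> B `<=` D -> prob D <= s.
    move=> gD BD; apply: ub_le_sup; first exact: hs.2.
    by exists D.
  have [bs|sb] := ltP (prob B) s.
    have e0 : 0 < (s - prob B) / 2 by lra.
    have [_ [C [gC BC ->]] lt] := sup_adherent e0 hs.
    exists C => _; split => // D gD BD; have := le D gD BD.
    by move: lt; rewrite -/s; lra.
  by exists B => _; split => // D gD BD; have := le D gD BD; lra.
pose S n := iter n f set0.
have gS n : good (S n).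
  elim: n => [|n ih]; first by split; [exact: measurable0|exact: sub0set|rewrite /S/= pr0].
  by have [] := fP _ ih.
have Sinc n : S n `<=` S n.+1 by have [] := fP _ (gS n).
have Smono n m : (n <= m)%N -> S n `<=` S m.
  move=> /subnK <-; elim: (m - n)%N => // k ih.
  by apply: subset_trans ih _; rewrite addSn; exact: Sinc.
pose B := \bigcup_n S n.
have mS n : measurable (S n) by have [] := gS n.
have mB : measurable B by apply: bigcup_measurable => n _; exact: mS.
have BA : B `<=` A by move=> w [n _]; have [_ + _] := gS n; apply.
have SB n : S n `<=` B by move=> w ?; exists n.
have cS : prob (S n) @[n --> \oo] --> prob B.
  have : P (S n) @[n --> \oo] --> P B.
    apply: nondecreasing_cvg_mu => // n m nm; exact/subsetPset/Smono.
  rewrite -prE// => /fine_cvgP[_ ]; exact.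
have Bt : prob B <= t.
  rewrite -(cvg_lim _ cS)//; apply: limr_le; first by apply/cvg_ex; exists (prob B).
  by near=> n; have [_ _] := gS n.
have gB : good B by [].
have Bmax D : good D -> B `<=` D -> prob D <= prob B.
  move=> gD BD; apply/ler_addgt0Pr => e e0.
  (* A good set containing [B] gains over [S n] at most twice what [S n.+1] does, and that gain is
     at most [e / 2] for large [n]. *)
  have e40 : 0 < e / 2 by lra.
  have /cvgrPdist_le /(_ _ e40)[n _ h] := cS.
  have := h n (leqnn n); have := h n.+1 (leqnSn n); rewrite /=.
  have [_ _ /(_ D gD (subset_trans (SB n) BD))] := fP _ (gS n).
  have : prob (S n) <= prob (S n.+1) by apply: prS.
  have : prob (S n.+1) <= prob B by apply: prS.
  rewrite -/(S n.+1) => h1 h2 h3; rewrite !ger0_norm; lra.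
exists B; split => //; apply/eqP; rewrite eq_le Bt/= leNgt; apply/negP => lt.
have mAB : measurable (A `\` B) by exact: measurableD.
have e := prD mA mB BA.
have [||D [mD DAB D0 Dt]] := @atomless_small (A `\` B) (t - prob B) mAB; [lra|lra|].
have BD : B `&` D = set0 by apply/seteqP; split => w //= [Bw /DAB[]].
have eU : prob (B `|` D) = prob B + prob D by exact: prU.
have := Bmax (B `|` D); rewrite eU => /(_ _ (@subsetUl _ _ _)) h.
have : prob B + prob D <= prob B; last by lra.
apply: h; split; [exact: measurableU| |lra].
by move=> w [/BA//|/DAB[]].
Unshelve. all: by end_near. Qed.

(** The pieces are cut one after the other from what remains of [A], the bound on the sum leaving
    room for each; labels outside [l] get the empty set. *)
Lemma atomless_partition (Q : finType) (A : set Om) (r : Q -> R) (l : seq Q) :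
  measurable A -> uniq l -> (forall x, 0 <= r x) ->
  \sum_(x <- l) r x <= prob A ->
  exists B : Q -> set Om, [/\ forall x, measurable (B x),
    forall x, B x `<=` A, forall x y, x != y -> B x `&` B y = set0
    & forall x, x \in l -> prob (B x) = r x].
Proof.
move=> + + r0; elim: l A => [|x l ih] A mA /=.
  move=> _ _; exists (fun=> set0); split => //.
    by move=> x; exact: sub0set.
  by move=> x y _; exact: set0I.
move=> /andP[xl ul]; rewrite big_cons => le.
have s0 : 0 <= \sum_(j <- l) r j by apply: sumr_ge0.
have [|C [mC CA Cr]] := @atomless_ivt A (r x) mA.
  by rewrite r0/=; lra.
have mD : measurable (A `\` C) by exact: measurableD.
have [|B [mB BA dB Br]] := ih (A `\` C) mD ul.
  by rewrite prD// Cr; lra.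
exists (fun y => if y == x then C else B y); split.
- by move=> y; case: ifP.
- by move=> y; case: ifP => // _; apply: (subset_trans (BA y)); exact: subDsetl.
- move=> y z yz; case: ifPn => [/eqP yx|yx]; case: ifPn => [/eqP zx|zx].
  + by rewrite yx zx eqxx in yz.
  + by apply/seteqP; split => w //= [Cw /BA[]].
  + by apply/seteqP; split => w //= [/BA[]].
  + exact: dB.
- move=> y; rewrite inE; case: ifPn => [/eqP -> _//|yx /=].
  exact: Br.
Qed.

(** Each fibre of [g] is cut into pieces of the prescribed measures. The pieces may miss a null part
    of the fibre, where [q] takes the default value [y0]; the measure belonging to [y0] is then
    found by subtraction. *)
Lemma atomless_joint_law (G Q : finType) (g : Om -> G) (w : G -> Q -> R) :
  fmeas g -> (forall x y, 0 <= w x y) ->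
  (forall x, \sum_y w x y = prob (g @^-1` [set x])) ->
  exists q : Om -> Q, fmeas q /\
    forall x y, prob (g @^-1` [set x] `&` q @^-1` [set y]) = w x y.
Proof.
move=> mg w0 wg.
(* Without labels the sums in [wg] would be empty and the whole space null. *)
have [y0] : inhabited Q.
  have [y _|Q0] := pickP (@predT Q); first by exists.
  exfalso; have := pr_sum mg (@measurableT _ Om); rewrite prT.
  rewrite big1; first by move/eqP; rewrite oner_eq0.
  move=> x _; rewrite setTI -wg big1// => y _.
  by have := Q0 y.
have /choice[B BP] : forall x, exists B : Q -> set Om,
    [/\ forall y, measurable (B y), forall y, B y `<=` g @^-1` [set x],
    forall y z, y != z -> B y `&` B z = set0 & forall y, prob (B y) = w x y].
  move=> x; have [|B [mB BA dB Br]] :=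
    @atomless_partition Q (g @^-1` [set x]) (w x) (index_enum Q) (mg x)
      (index_enum_uniq Q) (w0 x).
    by rewrite wg.
  by exists B; split => // y; rewrite Br// mem_index_enum.
have mB x y : measurable (B x y) by have [] := BP x.
pose q om := odflt y0 [pick y | `[< B (g om) y om >]].
have qB x y om : B x y om -> q om = y.
  move=> Bo; have [_ sub dis _] := BP x.
  have gx : g om = x by exact: sub Bo.
  rewrite /q gx; case: pickP => [z /asboolP Bz|/(_ y)/asboolP//] /=.
  apply/eqP/negPn/negP => zy.
  by have : (B x z `&` B x y) om by []; rewrite dis.
pose E x y := g @^-1` [set x] `&` q @^-1` [set y].
have Ex x y : y != y0 -> E x y = B x y.
  move=> yy0; apply/seteqP; split => [om [/= gx qy]|om Bo]; last first.
    have [_ sub _ _] := BP x.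
    by split; [exact: sub Bo|exact: qB Bo].
  move: qy; rewrite /q gx; case: pickP => [z /asboolP Bz /= <-//|_ /= e].
  by rewrite e eqxx in yy0.
have E0 x : E x y0 = g @^-1` [set x] `\` \bigcup_(y in [set y | y != y0]) B x y.
  apply/seteqP; split => [om [/= gx qy]|om [/= gx nB]].
    by split => //= -[y yy0 /qB]; rewrite qy => e; rewrite /= -e eqxx in yy0.
  split => //=; apply/eqP/negPn/negP => qn; apply: nB.
  by exists (q om) => //; rewrite -Ex.
have mE x y : measurable (E x y).
  have [->|/Ex->//] := eqVneq y y0; rewrite E0.
  apply: measurableD; first exact: mg.
  by apply: fin_bigcup_measurable; [exact: finite_finset|move=> z _; exact: mB].
have mq : fmeas q.
  move=> y; rewrite (_ : _ @^-1` _ = \bigcup_(x in setT) E x y).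
    by apply: fin_bigcup_measurable; [exact: finite_finset|].
  by apply/seteqP; split => [om /= <-|om [x _ []//]]; exists (g om).
exists q; split => // x y.
have [->|/Ex h] := eqVneq y y0; last first.
  by rewrite -[X in prob X]/(E x y) h; have [_ _ _ ->] := BP x.
have := pr_sum mq (mg x); rewrite -wg (bigD1 y0)//= [in RHS](bigD1 y0)//=.
rewrite [X in _ = _ + X](eq_bigr (w x)); first by move=> h; apply/esym; lra.
by move=> z /Ex; rewrite /E => ->; have [_ _ _ ->] := BP x.
Qed.

Lemma pr_joint_sum (G H : finType) (g : Om -> G) (h : Om -> H) x :
  fmeas g -> fmeas h ->
  \sum_y prob (g @^-1` [set x] `&` h @^-1` [set y]) = prob (g @^-1` [set x]).
Proof. by move=> mg mh; rewrite -pr_sum. Qed.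

(* [q] is drawn with the conditional law of [w] given [F], independently of
   [g]; then [q] agrees with a function of [g] with conditional probability at
   most that of the most likely label. *)
Lemma independent_copy (I Q G : finType) (F : Om -> I) (g : Om -> G)
    (w : I -> Q -> R) (r : R) :
  fmeas F -> fmeas g -> (forall i x, 0 <= w i x) ->
  (forall i, \sum_x w i x = prob (F @^-1` [set i])) ->
  (forall c : I -> Q, \sum_i w i (c i) <= r) ->
  exists q : Om -> Q, [/\ fmeas q,
    forall i x, prob (F @^-1` [set i] `&` q @^-1` [set x]) = w i x
    & forall h : G -> Q, prob [set om | q om = h (g om)] <= r].
Proof.
move=> mF mg w0 wF wr.
pose p i := prob (F @^-1` [set i]).
pose pg i y := prob (F @^-1` [set i] `&` g @^-1` [set y]).
have pgs i : \sum_y pg i y = p i by exact: pr_joint_sum.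
have w_p i x : p i = 0 -> w i x = 0.
  move=> pi0; apply/eqP; rewrite eq_le w0 andbT -pi0 /p -wF.
  by rewrite (bigD1 x)//= lerDl sumr_ge0.
have pg_p i y : p i = 0 -> pg i y = 0.
  move=> pi0; apply/eqP; rewrite eq_le pr_ge0 andbT -pi0 -pgs.
  by rewrite (bigD1 y)//= lerDl sumr_ge0// => *; exact: pr_ge0.
(* The weight [w i x] times the conditional probability of [g = y] given [F = i]. On a null fibre
   the quotient is 0 by convention, which agrees with the vanishing of both weights there. *)
pose W (k : I * G) x := w k.1 x * (pg k.1 k.2 / p k.1).
have W0 k x : 0 <= W k x by rewrite mulr_ge0// divr_ge0// pr_ge0.
have mFg := fmeas_pair mF mg.
have eFg i y : (fun om => (F om, g om)) @^-1` [set (i, y)] =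
    F @^-1` [set i] `&` g @^-1` [set y].
  by apply/seteqP; split => om /= [-> ->].
have Wk (k : I * G) :
    \sum_x W k x = prob ((fun om => (F om, g om)) @^-1` [set k]).
  case: k => i y; rewrite eFg -mulr_suml wF -/(p i) -/(pg i y).
  have [pi0|pi0] := eqVneq (p i) 0; last by rewrite /= mulrC divfK.
  by rewrite /= pi0 mul0r pg_p.
have [q [mq qW]] := atomless_joint_law mFg W0 Wk.
have sW i x : \sum_y W (i, y) x = w i x.
  rewrite /W /= -mulr_sumr -mulr_suml pgs.
  have [pi0|pi0] := eqVneq (p i) 0; last by rewrite divff// mulr1.
  by rewrite w_p// mul0r.
exists q; split => // [i x|h].
  rewrite (pr_sum mg); last by apply: measurableI; [exact: mF|exact: mq].
  rewrite -sW; apply: eq_bigr => y _; rewrite -qW eFg; congr prob.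
  by rewrite -!setIA; congr (_ `&` _); rewrite setIC.
have [y0] : inhabited Q.
  have [y _|Q0] := pickP (@predT Q); first by exists.
  exfalso; have := pr_sum mF (@measurableT _ Om); rewrite prT.
  rewrite big1; first by move/eqP; rewrite oner_eq0.
  by move=> i _; rewrite setTI -wF big1// => y _; have := Q0 y.
(* A most likely label on the fibre of [i]: replacing the guess [h] by [c] can only increase the
   weight. *)
pose c i := [arg max_(x > y0) w i x]%O.
have wc i x : w i x <= w i (c i).
  by rewrite /c; case: (@Order.TotalTheory.arg_maxP _ _ Q y0 predT (w i)) => // z _; exact.
pose T := (I * G)%type.
have mA : measurable [set om | q om = h (g om)].
  exact: (fmeas_set [set z : Q * G | z.1 = h z.2] (fmeas_pair mq mg)).
rewrite (pr_sum mFg mA); apply: (le_trans _ (wr c)).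
rewrite (eq_bigr (fun k : T => W k (h k.2))); last first.
  case=> i y _; rewrite -qW; congr prob; apply/seteqP.
  split => om /=; first by move=> [e [Fi gy]]; rewrite e Fi gy.
  by move=> [[Fi gy] e]; rewrite e Fi gy.
rewrite -(pair_bigA _ (fun i y => W (i, y) (h y)))/=.
apply: ler_sum => i _; rewrite -(sW i (c i)); apply: ler_sum => y _.
by rewrite ler_wpM2r// divr_ge0// pr_ge0.
Qed.

(** Each copy is drawn independently, given [F], of the tuple of all earlier ones; with the
    coordinates of this tuple as [h], all coincidences are bounded at once. *)
Lemma independent_copies (I Q : finType) (F : Om -> I) (w : I -> Q -> R)
    (r : R) :
  fmeas F -> (forall i x, 0 <= w i x) ->
  (forall i, \sum_x w i x = prob (F @^-1` [set i])) ->
  (forall c : I -> Q, \sum_i w i (c i) <= r) ->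
  exists q : nat -> Om -> Q, [/\ forall n, fmeas (q n),
    forall n i x, prob (F @^-1` [set i] `&` q n @^-1` [set x]) = w i x
    & forall m n, (m < n)%N -> prob [set om | q n om = q m om] <= r].
Proof.
move=> mF w0 wF wr.
pose spec (s : seq (Om -> Q)) (q : Om -> Q) :=
  (forall j : 'I_(size s), fmeas (tnth (in_tuple s) j)) -> [/\ fmeas q,
    forall i x, prob (F @^-1` [set i] `&` q @^-1` [set x]) = w i x
    & forall j : 'I_(size s), prob [set om | q om = tnth (in_tuple s) j om] <= r].
have /choice[f fP] : forall s, exists q, spec s q.
  move=> s; have [ms|nms] := pselect
      (forall j : 'I_(size s), fmeas (tnth (in_tuple s) j)).
    have [q [mq qw qr]] := independent_copy mF (fmeas_ffun ms) w0 wF wr.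
    exists q => _; split => // j.
    have := qr (fun y : {ffun 'I_(size s) -> Q} => y j).
    congr (prob _ <= r); apply/seteqP.
    by split => om /=; rewrite ffunE.
  (* For a list that is not measurable [spec] asks nothing, and any map will do. *)
  have [q _] := independent_copy mF (fmeas_bool (@measurableT _ Om)) w0 wF wr.
  by exists q.
pose build := fix build n :=
  if n is n'.+1 then rcons (build n') (f (build n')) else [::].
have szb n : size (build n) = n by elim: n => //= n ih; rewrite size_rcons ih.
have nthb n m q0 : (m < n)%N -> nth q0 (build n) m = f (build m).
  elim: n => // n ih; rewrite ltnS leq_eqVlt /= nth_rcons szb => /orP[/eqP ->|h].
    by rewrite ltnn eqxx.
  by rewrite h ih.
have mb n (j : 'I_(size (build n))) : fmeas (tnth (in_tuple (build n)) j).
  elim/ltn_ind: n j => n ih j.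
  have jn : (j < n)%N by rewrite -{2}(szb n).
  by rewrite (tnth_nth (f [::]))/= nthb//; have [] := fP _ (ih j jn).
exists (fun n => f (build n)); split.
- by move=> n; have [] := fP _ (mb n).
- by move=> n; have [] := fP _ (mb n).
- move=> m n mn; have [_ _ h] := fP _ (mb n).
  have mn' : (m < size (build n))%N by rewrite szb.
  by have := h (Ordinal mn'); rewrite (tnth_nth (f [::]))/= nthb.
Qed.

End Sierpinski.
End Probability.

(** * Infinite cardinals and Skolem closures *)

Section Cardinals.
Variable Y : Type.
Implicit Types S D : set Y.

Definition inj_between S D (f : Y -> Y) :=
  (forall x, S x -> D (f x)) /\
  forall x y, S x -> S y -> f x = f y -> x = y.

(** A maximal partial injection, viewed as a graph, is total on [S] or onto [D]: otherwise a pair of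
    missing points could be added. *)
Lemma inj_between_total S D :
  (exists f, inj_between S D f) \/ (exists f, inj_between D S f).
Proof.
pose ok (G : set (Y * Y)) := [/\ forall x y, G (x, y) -> S x /\ D y,
  forall x y y', G (x, y) -> G (x, y') -> y = y'
  & forall x x' y, G (x, y) -> G (x', y) -> x = x'].
have [|G [[GSD Gf Gi] Gmax]] := @Zorn_bigcup _ ok.
  move=> F Fok tot.
  have two a b : (\bigcup_(X in F) X) a -> (\bigcup_(X in F) X) b ->
      exists X, [/\ F X, X a & X b].
    move=> [X FX Xa] [X' FX' Xb]; have [h|h] := tot _ _ FX FX'.
      by exists X'; split => //; exact: h.
    by exists X; split => //; exact: h.
  split.
  - by move=> x y [X FX Xxy]; have [+ _ _] := Fok _ FX; apply.
  - move=> x y y' h h'; have [X [FX X1 X2]] := two _ _ h h'.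
    by have [_ + _] := Fok _ FX; apply; [exact: X1|exact: X2].
  - move=> x y y' h h'; have [X [FX X1 X2]] := two _ _ h h'.
    by have [_ _ +] := Fok _ FX; apply; [exact: X1|exact: X2].
have [dS|/existsNP[x /not_implyP[Sx nx]]] :=
    pselect (forall x, S x -> exists y, G (x, y)).
  left; have /choice[f fP] : forall x, exists y, S x -> G (x, y).
    move=> x; have [Sx|nSx] := pselect (S x); last by exists x.
    by have [y Gxy] := dS _ Sx; exists y.
  exists f; split=> [x Sx|x y Sx Sy fxy].
    by have [] := GSD _ _ (fP _ Sx).
  by apply: (Gi _ _ (f x)); [exact: fP|rewrite fxy; exact: fP].
have [dD|/existsNP[y /not_implyP[Dy ny]]] :=
    pselect (forall y, D y -> exists x, G (x, y)).
  right; have /choice[f fP] : forall y, exists x, D y -> G (x, y).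
    move=> y; have [Dy|nDy] := pselect (D y); last by exists y.
    by have [z Gxy] := dD _ Dy; exists z.
  exists f; split=> [y Dy|y z Dy Dz fyz].
    by have [] := GSD _ _ (fP _ Dy).
  by apply: (Gf (f y)); [exact: fP|rewrite fyz; exact: fP].
exfalso; apply: (Gmax (G `|` [set (x, y)])).
  split; first exact: subsetUl.
  by move=> /(_ (x, y)) h; apply: nx; exists y; apply: h; right.
split.
- by move=> a b [/GSD//|[-> ->]].
- move=> a b b' [h|[ax ->]] [h'|[ax' ->]] //; first exact: (Gf a).
    by exfalso; apply: nx; exists b; rewrite -ax'.
  by exfalso; apply: nx; exists b'; rewrite -ax.
- move=> a a' b [h|[-> bx]] [h'|[-> bx']] //; first exact: (Gi _ _ b).
    by exfalso; apply: ny; exists a; rewrite -bx'.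
  by exfalso; apply: ny; exists a'; rewrite -bx.
Qed.

Definition pairing S (p : Y -> Y -> Y) :=
  (forall x y, S x -> S y -> S (p x y)) /\
  forall x y x' y', S x -> S y -> S x' -> S y' ->
    p x y = p x' y' -> x = x' /\ y = y'.

Lemma nat_pairing (e : nat -> Y) : injective e ->
  exists p, pairing (range e) p.
Proof.
move=> ei; have /choice[k kP] : forall x, exists n, range e x -> e n = x.
  move=> x; have [[n _ <-]|nx] := pselect (range e x); first by exists n.
  by exists 0%N => /nx.
exists (fun x y => e (choice.pickle (k x, k y))); split => [x y _ _|].
  by exists (choice.pickle (k x, k y)).
move=> x y x' y' rx ry rx' ry' /ei /(pcan_inj choice.pickleK)[kx ky].
by rewrite -(kP _ rx) -(kP _ ry) kx ky !kP.
Qed.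

(* The complement of a maximal set with a pairing function injects into it,
   for otherwise the set embeds into its complement and the pairing function extends
   to the union with the image. *)
Lemma infinite_pairing (e : nat -> Y) : injective e ->
  exists p, pairing setT p.
Proof.
move=> ei; have [p0 p0P] := nat_pairing ei.
(* The domains contain the range of [e]: this bounds the empty chain by [t0] and gives the maximal
   domain two distinct elements, to be used as tags. *)
pose T := {t : set Y * (Y -> Y -> Y) | `[< pairing t.1 t.2 /\ range e `<=` t.1 >]}.
have t0P : `[< pairing (range e, p0).1 (range e, p0).2 /\
    range e `<=` (range e, p0).1 >] by apply/asboolP; split.
pose t0 : T := exist _ (range e, p0) t0P.
pose le (s t : T) := `[< (val s).1 `<=` (val t).1 /\
  forall x y, (val s).1 x -> (val s).1 y -> (val s).2 x y = (val t).2 x y >].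
have [||A totA|[[S p] /= Sp] maxS] := @ZL_preorder T t0 le.
- by move=> s; apply/asboolP; split.
- move=> r s t /asboolP[h1 h2] /asboolP[h3 h4]; apply/asboolP; split.
    exact: subset_trans h3.
  by move=> x y rx ry; rewrite h2// h4//; exact: h1.
- have [[t At]|nA] := pselect (exists t, A t); last first.
    by exists t0 => s As; exfalso; apply: nA; exists s.
  pose S := \bigcup_(t in A) (val t).1.
  have tot s s' : A s -> A s' -> exists u, [/\ A u, le s u & le s' u].
    move=> As As'; have [h|h] := totA _ _ As As'; [exists s'|exists s];
      by split => //; apply/asboolP; split.
  have two x y : S x -> S y -> exists s, [/\ A s, (val s).1 x & (val s).1 y].
    move=> [s As sx] [s' As' sy]; have [u [Au /asboolP[h _] /asboolP[h' _]]] := tot _ _ As As'.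
    by exists u; split => //; [exact: h|exact: h'].
  have /choice[q qP] : forall xy : Y * Y, exists z, forall s, A s ->
      (val s).1 xy.1 -> (val s).1 xy.2 -> z = (val s).2 xy.1 xy.2.
    move=> [x y]; have [[Sx Sy]|nS] := pselect (S x /\ S y); last first.
      by exists x => s As sx sy; exfalso; apply: nS; split; exists s.
    have [s [As sx sy]] := two _ _ Sx Sy; exists ((val s).2 x y) => s' As' /= sx' sy'.
    have [u [Au /asboolP[_ h] /asboolP[_ h']]] := tot _ _ As As'.
    by rewrite h// h'.
  have tP : `[< pairing (S, fun x y => q (x, y)).1 (S, fun x y => q (x, y)).2
      /\ range e `<=` (S, fun x y => q (x, y)).1 >].
    apply/asboolP; split => /=; last first.
      move=> x rx; exists t => //; have /asboolP[_ h] := valP t; exact: h.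
    split=> [x y Sx Sy|x y x' y' Sx Sy Sx' Sy'].
      have [s [As sx sy]] := two _ _ Sx Sy; exists s => //.
      rewrite (qP (x, y) s As sx sy); have /asboolP[[h _] _] := valP s; exact: h.
    have [s [As sx sy]] := two _ _ Sx Sy.
    have [s' [As' sx' sy']] := two _ _ Sx' Sy'.
    have [u [Au /asboolP[h1 _] /asboolP[h2 _]]] := tot _ _ As As'.
    rewrite (qP (x, y) u Au (h1 _ sx) (h1 _ sy)).
    rewrite (qP (x', y') u Au (h2 _ sx') (h2 _ sy')).
    by have /asboolP[[_ h] _] := valP u; apply: h; [exact: h1|exact: h1|exact: h2|exact: h2].
  pose u : T := exist _ (S, fun x y => q (x, y)) tP.
  exists u => s As; apply/asboolP; split => /=.
    by move=> x sx; exists s.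
  by move=> x y sx sy; rewrite (qP (x, y) s).
have /asboolP[/= [pS pi] eS] := Sp.
pose a := e 0%N; pose b := e 1%N.
have Sa : S a by apply: eS; exists 0%N.
have Sb : S b by apply: eS; exists 1%N.
have ab : a <> b by move=> /ei.
suff [g [gS gi]] : exists g, inj_between setT S g.
  exists (fun x y => p (g x) (g y)); split => // x y x' y' _ _ _ _.
  by move=> /pi[]; [exact: gS|exact: gS|exact: gS|exact: gS|
    move=> /gi-> // /gi->].
have [[f [fS fi]]|[f [fS fi]]] := inj_between_total (~` S) S.
  (* The tags [a] and [b] keep the points of [S] apart from the others, so all of [Y] embeds in
     [S]. *)
  exists (fun x => if `[< S x >] then p a x else p b (f x)); split.
    by move=> x _; case: asboolP => Sx; apply: pS => //; exact: fS.
  move=> x y _ _; case: asboolP => Sx; case: asboolP => Sy.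
  - by move=> /pi[].
  - by move=> /pi[] => //; exact: fS.
  - by move=> /pi[] => //; [exact: fS|move=> /esym].
  - by move=> /pi[] => //; [exact: fS|exact: fS|move=> _ /fi; exact].
exfalso; pose Z := f @` S; pose S' := S `|` Z.
have ZS x : Z x -> ~ S x by move=> [y Sy <-]; exact: fS.
have /choice[k kP] : forall x, exists y, Z x -> S y /\ f y = x.
  move=> x; have [[y Sy fy]|nZ] := pselect (Z x); first by exists y.
  by exists x.
pose g x := if `[< S x >] then p a x else p b (k x).
have gS x : S' x -> S (g x).
  move=> [Sx|Zx]; rewrite /g.
    by rewrite asboolT//; exact: pS.
  by rewrite asboolF; [apply: pS => //; have [] := kP _ Zx|exact: ZS].
have gi x y : S' x -> S' y -> g x = g y -> x = y.
  have kS z : S' z -> ~ S z -> S (k z) /\ f (k z) = z by move=> [|/kP].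
  move=> S'x S'y; rewrite /g; case: asboolP => Sx; case: asboolP => Sy.
  - by move=> /pi[].
  - by move=> /pi[] => //; have [] := kS _ S'y Sy.
  - by move=> /pi[] => //; [have [] := kS _ S'x Sx|move=> /esym].
  - have [kx fx] := kS _ S'x Sx; have [ky fy] := kS _ S'y Sy.
    by move=> /pi[] // _; rewrite -{2}fx -{2}fy => ->.
(* New pairs take their values in [Z], which is disjoint from [S], and so do not collide with old
   ones; [g] embeds [S'] in [S] by means of the tags. *)
pose p' x y := if `[< S x /\ S y >] then p x y else f (p (g x) (g y)).
have tP : `[< pairing (S', p').1 (S', p').2 /\ range e `<=` (S', p').1 >].
  apply/asboolP; split => /=; last by move=> x /eS; left.
  split=> [x y S'x S'y|x y x' y' S'x S'y S'x' S'y'].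
    rewrite /p'; case: asboolP => [[Sx Sy]|_]; first by left; exact: pS.
    by right; exists (p (g x) (g y)) => //; apply: pS; exact: gS.
  have Spg u v : S' u -> S' v -> S (p (g u) (g v)).
    by move=> *; apply: pS; exact: gS.
  rewrite /p'; case: asboolP => [[Sx Sy]|_]; case: asboolP => [[Sx' Sy']|_].
  - exact: pi.
  - by move=> e1; case: (fS _ (Spg _ _ S'x' S'y')); rewrite -e1; exact: pS.
  - by move=> e1; case: (fS _ (Spg _ _ S'x S'y)); rewrite e1; exact: pS.
  - move=> /fi; move=> /(_ (Spg _ _ S'x S'y) (Spg _ _ S'x' S'y')) /pi[]; try exact: gS.
    by move=> /gi-> // /gi->.
pose u : T := exist _ (S', p') tP.
have : le u (exist _ (S, p) Sp).
  apply: maxS; apply/asboolP; split => /=; first exact: subsetUl.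
  by move=> x y Sx Sy; rewrite /p' asboolT.
move=> /asboolP[/= /(_ (f a)) h _]; apply: (fS a) => //; apply: h; right.
by exists a.
Qed.

End Cardinals.

(** * Closure under countably many finitary operations *)

Section SkolemClosure.
Variables (X I : Type) (x0 : X).

Definition allin (D : set X) (s : seq X) :=
  forall k, (k < size s)%N -> D (nth x0 s k).

(** Names for finite sequences: single elements from [A] ([SA]) and [C0] ([SC]), concatenations, and
    the operation [i] applied to the entries at positions [ix] of a named sequence. Counting names
    bounds the closure without building it in stages. *)
Inductive sterm (Y : Type) : Type :=
| SNil
| SA (y : Y)
| SC (y : Y)
| SCat (s t : sterm Y)
| SOp (i : I) (ix : seq nat) (t : sterm Y).

Fixpoint seval (Y : Type) (a c : Y -> X) (F : I -> seq X -> seq X)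
    (t : sterm Y) : seq X :=
  match t with
  | SNil => [::]
  | SA y => [:: a y]
  | SC y => [:: c y]
  | SCat s t => seval a c F s ++ seval a c F t
  | SOp i ix t => F i [seq nth x0 (seval a c F t) k | k <- ix]
  end.

(** Trees over [Y] are coded in [Y] by a pairing function, [e 0] to [e 4] being the tags of the
    constructors. The extra number is the position of an entry, as a name denotes a whole
    sequence. *)
Lemma sterm_inj (Y : Type) (e : nat -> Y) :
  injective e -> countable [set: I] ->
  exists code : sterm Y * nat -> Y, injective code.
Proof.
move=> ei /countable_injP[ci ciP].
have cii i j : ci i = ci j -> i = j by apply: ciP; rewrite inE.
have [p [_ pP]] := infinite_pairing ei.
have pi x y x' y' : p x y = p x' y' -> x = x' /\ y = y' by exact: pP.
pose code := fix code (t : sterm Y) := match t with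
  | SNil => p (e 0%N) (e 0%N)
  | SA y => p (e 1%N) y
  | SC y => p (e 2%N) y
  | SCat s t => p (e 3%N) (p (code s) (code t))
  | SOp i ix t => p (e 4%N) (p (e (choice.pickle (ci i, ix))) (code t))
  end.
have codei : injective code.
  elim=> [|y|y|s ihs t iht|i ix t iht] [|y'|y'|s' t'|i' ix' t'] //= /pi[]
    /ei // _.
  - by move=> ->.
  - by move=> ->.
  - by move=> /pi[/ihs -> /iht ->].
  - by move=> /pi[/ei/(pcan_inj choice.pickleK)[/cii -> ->] /iht ->].
exists (fun tk => p (code tk.1) (e tk.2)) => -[t k] [t' k'] /= /pi[].
by move=> /codei -> /ei ->.
Qed.

Lemma skolem_closure (good : I -> seq X -> seq X -> Prop) (A B C0 : set X) :
  countable [set: I] -> C0 `<=` B -> (C0 #<= plus_aleph0 A)%card ->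
  exists C : set X, [/\ C0 `<=` C, C `<=` B, (C #<= plus_aleph0 A)%card
    & forall i s, allin (A `|` C) s ->
        (exists r, allin B r /\ good i s r) ->
        exists r, allin C r /\ good i s r].
Proof.
move=> cI C0B C0A.
pose Y := set_type (plus_aleph0 A).
have yP z : plus_aleph0 A z -> {y : Y | val y = z}.
  by move=> h; exists (SigSub (mem_set h)).
pose e n : Y := sval (@yP (inr n) Logic.I).
have ei : injective e.
  move=> m n; rewrite /e; case: (yP _ _) => x /= ex; case: (yP _ _) => y /= ey.
  by move=> xy; move: ex; rewrite xy ey => -[].
have [code codei] := sterm_inj ei cI.
pose a (y : Y) : X := if val y is inl x then x else x0.
have aP x : A x -> exists y, a y = x.
  by move=> Ax; have [y ey] := @yP (inl x) Ax; exists y; rewrite /a ey.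
have [c cP] : exists c : Y -> X, forall x, C0 x -> exists y, c y = x.
  have /pfcard_geP[->|[g]] := C0A; first by exists (fun=> x0).
  exists (fun y => g (val y)) => x C0x.
  have [z /yP[y <-] gz] := 'surj_g C0x.
  by exists y.
have /choice[F0 F0P] : forall is_ : I * seq X, exists r,
    (exists r, allin B r /\ good is_.1 is_.2 r) ->
    allin B r /\ good is_.1 is_.2 r.
  move=> [i s]; have [[r rP]|nr] := pselect (exists r, allin B r /\ good i s r).
    by exists r.
  by exists [::].
pose F i s := F0 (i, s); pose ev := seval a c F.
(* Names may also denote elements outside [B], such as inputs from [A]; these are not put in [C]. *)
pose C := B `&` [set x | exists t k, (k < size (ev t))%N /\ nth x0 (ev t) k = x].
exists C; split.
- move=> x C0x; split; first exact: C0B.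
  by have [y ey] := cP x C0x; exists (SC y), 0%N.
- by move=> x [].
- have /choice[h hP] : forall x, exists tk : sterm Y * nat, C x ->
      nth x0 (ev tk.1) tk.2 = x.
    move=> x; have [[_ [t [k [_ ex]]]]|nC] := pselect (C x).
      by exists (t, k).
    by exists (SNil Y, 0%N).
  pose f x := val (code (h x)).
  have fi : {in C &, injective f}.
    move=> x y /set_mem Cx /set_mem Cy /val_inj/codei e'.
    by rewrite -(hP x Cx) -(hP y Cy) e'.
  rewrite (card_le_eql (card_esym (inj_card_eq fi))).
  apply: subset_card_le => _ [x _ <-].
  exact: set_mem (valP (code (h x))).
- move=> i s sAC ex.
  (* A finite sequence in [A] and [C] is read off from a single name: the names of its entries are
     concatenated, and the later positions are shifted by the length of the first sequence. *)
  have [t [ix est]] : exists t ix, s = [seq nth x0 (ev t) k | k <- ix].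
    elim: s sAC {ex} => [|x s ih] sAC; first by exists (SNil Y), [::].
    have [|t' [ix' ->]] := ih; first by move=> k ks; exact: (sAC k.+1).
    have [t [k [kt <-]]] : exists t k, (k < size (ev t))%N /\ nth x0 (ev t) k = x.
      have [Ax|[]//] := sAC 0%N isT.
      by have [y ey] := aP x Ax; exists (SA y), 0%N.
    exists (SCat t t'), (k :: [seq (size (ev t) + j)%N | j <- ix']) => /=.
    rewrite -/ev nth_cat kt -map_comp; congr (_ :: _); apply: eq_map => j /=.
    by rewrite nth_cat ltnNge leq_addr /= addKn.
  have [Br gr] := F0P (i, s) ex; exists (F i s); split => // k ks.
  split; first exact: Br.
  have eF : F i s = ev (SOp i ix t) by rewrite est.
  by exists (SOp i ix t), k; rewrite -eF.
Qed.

End SkolemClosure.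

(** * Countability of the set of formulas *)

Section CountableForms.
Variables (L : language) (cf : fsym L -> nat) (cr : rsym L -> nat).
Hypotheses (cfi : injective cf) (cri : injective cr).

(** [GenTree.tree nat] is countable. Arities are not coded, since the symbol determines them. *)
Fixpoint tcode n (t : term L n) : GenTree.tree nat :=
  match t with
  | Var i => GenTree.Leaf (nat_of_ord i)
  | App f ts => GenTree.Node (cf f) [seq tcode (ts i) | i <- enum 'I_(far f)]
  end.

Fixpoint fcode n (phi : form L n) : GenTree.tree nat :=
  match phi with
  | FEq t u => GenTree.Node 0 [:: tcode t; tcode u]
  | FRel r ts => GenTree.Node 1
      (GenTree.Leaf (cr r) :: [seq tcode (ts i) | i <- enum 'I_(rar r)])
  | FNot phi => GenTree.Node 2 [:: fcode phi]
  | FAnd phi psi => GenTree.Node 3 [:: fcode phi; fcode psi]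
  | FEx phi => GenTree.Node 4 [:: fcode phi]
  end.

Lemma tcode_inj n : injective (@tcode n).
Proof.
elim=> [i|f ts ih] [j|g us] //=.
  by case=> /ord_inj ->.
case=> /cfi fg; case: g / fg us => us /eq_in_map e.
congr App; apply/funext => i; apply: ih; apply: e; exact: mem_enum.
Qed.

Lemma fcode_inj n : injective (@fcode n).
Proof.
move=> phi; elim: phi => {n} [n t u|n r ts|n phi ih|n phi ih psi ih'|n phi ih]
  [t' u'|r' ts'|phi'|phi' psi'|phi'] //=.
- by case=> /tcode_inj -> /tcode_inj ->.
- case=> /cri rr'; case: r' / rr' ts' => ts' /eq_in_map e.
  congr FRel; apply/funext => i; apply: tcode_inj; apply: e; exact: mem_enum.
- by case=> /ih ->.
- by case=> /ih -> /ih' ->.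
- by case=> /ih ->.
Qed.

End CountableForms.

Lemma countable_forms (L : language) : countable_language L ->
  countable [set: {l : nat & form L l}].
Proof.
move=> [/countable_injP[cf cfP] /countable_injP[cr crP]].
have cfi : injective cf by move=> x y; apply: cfP; rewrite inE.
have cri : injective cr by move=> x y; apply: crP; rewrite inE.
apply/countable_injP; exists (fun x : {l : nat & form L l} =>
  choice.pickle (tag x, fcode cf cr (tagged x))).
move=> [l phi] [l' phi'] _ _ /(pcan_inj choice.pickleK)[/= e].
by case: l' / e phi' => phi' /(fcode_inj cfi cri) ->.
Qed.

(** * Definable predicates *)

Section Tuples.
Variables (X : Type) (n : nat).

Lemma scons0 (a : X) (v : 'I_n -> X) : scons a v ord0 = a.
Proof. by rewrite /scons unlift_none. Qed.

Lemma sconsS (a : X) (v : 'I_n -> X) i : scons a v (lift ord0 i) = v i.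
Proof. by rewrite /scons liftK. Qed.

Lemma scons_ind (Q : 'I_n.+1 -> Prop) :
  Q ord0 -> (forall i, Q (lift ord0 i)) -> forall i, Q i.
Proof. by move=> Q0 QS i; case: (unliftP ord0 i) => [j|] ->. Qed.

Lemma scons_eq (v : 'I_n -> X) (w : 'I_n.+1 -> X) a :
  w ord0 = a -> (forall i, w (lift ord0 i) = v i) -> w = scons a v.
Proof.
move=> w0 wS; apply/funext; apply: scons_ind => [|i]; rewrite ?scons0//.
by rewrite sconsS.
Qed.

Lemma fcat_scons (a : X) (v : 'I_n -> X) :
  fcat (fun _ : 'I_1 => a) v = scons a v.
Proof.
pose w : 'I_n.+1 -> X := fcat (fun _ : 'I_1 => a) v.
suff : w = scons a v by [].
apply: scons_eq; rewrite /w /fcat.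
  rewrite (_ : ord0 = lshift n (ord0 : 'I_1)); last exact: val_inj.
  by rewrite (unsplitK (inl _)).
move=> i; rewrite (_ : lift ord0 i = rshift 1 i); last exact: val_inj.
by rewrite (unsplitK (inr _)).
Qed.

Lemma fcat_nil (u : 'I_0 -> X) (v : 'I_n -> X) : fcat u v = v.
Proof.
apply/funext => i; rewrite /fcat (_ : fintype.split i = inr i)//.
by rewrite -[i in LHS](_ : rshift 0 i = i) ?(unsplitK (inr _))//; exact: val_inj.
Qed.

End Tuples.

Lemma scons_comp (X Z : Type) n (f : X -> Z) a (v : 'I_n -> X) :
  (fun i => f (scons a v i)) = scons (f a) (fun i => f (v i)).
Proof. by apply: scons_eq => [|i]; rewrite ?scons0 ?sconsS. Qed.

Section Definability.
Variables (L : language) (M : structure L).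

Lemma teval_ren m n (s : 'I_m -> 'I_n) (v : 'I_n -> M) (t : term L m) :
  teval v (tren s t) = teval (fun i => v (s i)) t.
Proof.
by elim: t => //= f ts ih; congr fint; apply/funext => i; exact: ih.
Qed.

Lemma sat_ren m n (s : 'I_m -> 'I_n) (phi : form L m) (v : 'I_n -> M) :
  sat (fren s phi) v <-> sat phi (fun i => v (s i)).
Proof.
elim: phi n s v => {m} [m t u|m r ts|m phi ih|m phi ih psi ih'|m phi ih] n s v /=.
- by rewrite !teval_ren.
- by under eq_fun do rewrite teval_ren.
- by rewrite ih.
- by rewrite ih ih'.
- have e a : (fun i => scons a v (scons ord0 (fun i => lift ord0 (s i)) i)) =
      scons a (fun i => v (s i)).
    by apply: scons_eq => [|i]; rewrite ?scons0 ?sconsS.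
  by split=> -[a h]; exists a; move: h; rewrite ih e.
Qed.

(** Definability in [M] without parameters, as a property of relations: formulas are then obtained
    from closure properties instead of being written down. *)
Definition fdef n (Q : ('I_n -> M) -> Prop) :=
  exists phi : form L n, forall v, sat phi v <-> Q v.

Lemma fdef_ext n (Q Q' : ('I_n -> M) -> Prop) :
  (forall v, Q v <-> Q' v) -> fdef Q -> fdef Q'.
Proof. by move=> e [phi h]; exists phi => v; rewrite h. Qed.

Lemma fdef_sat n (phi : form L n) : fdef (fun v => sat phi v).
Proof. by exists phi. Qed.

Lemma fdef_ren m n (s : 'I_m -> 'I_n) (Q : ('I_m -> M) -> Prop) :
  fdef Q -> fdef (fun v => Q (fun i => v (s i))).
Proof. by move=> [phi h]; exists (fren s phi) => v; rewrite sat_ren. Qed.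

Lemma fdef_not n (Q : ('I_n -> M) -> Prop) : fdef Q -> fdef (fun v => ~ Q v).
Proof. by move=> [phi h]; exists (FNot phi) => v /=; rewrite h. Qed.

Lemma fdef_and n (Q Q' : ('I_n -> M) -> Prop) :
  fdef Q -> fdef Q' -> fdef (fun v => Q v /\ Q' v).
Proof.
by move=> [phi h] [psi h']; exists (FAnd phi psi) => v /=; rewrite h h'.
Qed.

Lemma fdef_or n (Q Q' : ('I_n -> M) -> Prop) :
  fdef Q -> fdef Q' -> fdef (fun v => Q v \/ Q' v).
Proof.
move=> dQ dQ'.
apply: fdef_ext (fdef_not (fdef_and (fdef_not dQ) (fdef_not dQ'))) => v.
by rewrite not_andE !notK.
Qed.

Lemma fdef_ex n (Q : ('I_n.+1 -> M) -> Prop) :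
  fdef Q -> fdef (fun v => exists a, Q (scons a v)).
Proof.
by move=> [phi h]; exists (FEx phi) => v /=; split => -[a]; exists a; apply/h.
Qed.

Lemma fdef_eq n (i j : 'I_n) : fdef (fun v => v i = v j).
Proof. by exists (FEq (Var L i) (Var L j)). Qed.

Lemma fdef_const n (b : Prop) : fdef (fun _ : 'I_n -> M => b).
Proof.
have dT : fdef (fun _ : 'I_n -> M => True).
  apply: fdef_ext (fdef_ex (fdef_eq ord0 ord0)) => v; split => // _.
  by have [a] := dom_inhabited M; exists a.
have [hb|nb] := pselect b; first by apply: fdef_ext dT.
by apply: fdef_ext (fdef_not dT) => v; split => [/(_ I)|/nb].
Qed.

Lemma fdef_all n (J : finType) (Q : J -> ('I_n -> M) -> Prop) :
  (forall j, fdef (Q j)) -> fdef (fun v => forall j, Q j v).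
Proof.
move=> dQ; have H (l : seq J) : fdef (fun v => forall j, j \in l -> Q j v).
  elim: l => [|j l ih]; first by apply: fdef_ext (@fdef_const n True).
  apply: fdef_ext (fdef_and (dQ j) ih) => v; split => [[h h'] k|h].
    by rewrite inE => /orP[/eqP ->//|/h'].
  by split => [|k kl]; apply: h; rewrite inE ?eqxx// kl orbT.
apply: fdef_ext (H (enum J)) => v; split => [h j|h j _]; last exact: h.
by apply: h; rewrite mem_enum.
Qed.

Lemma fdef_any n (J : finType) (Q : J -> ('I_n -> M) -> Prop) :
  (forall j, fdef (Q j)) -> fdef (fun v => exists j, Q j v).
Proof.
move=> dQ; have := fdef_not (fdef_all (fun j => fdef_not (dQ j))).
by apply: fdef_ext => v; split => [/existsNP[j /contrapT]|[j Qj] /(_ j)//]; exists j.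
Qed.

Lemma fdef_ffun n (J : finType) (Q : J -> ('I_n -> M) -> Prop)
    (p : {ffun J -> bool}) :
  (forall j, fdef (Q j)) -> fdef (fun v => [ffun j => `[< Q j v >]] = p).
Proof.
move=> dQ; have H j : fdef (fun v => `[< Q j v >] = p j).
  case: (p j); last first.
    apply: fdef_ext (fdef_not (dQ j)) => v.
    by split => [h|/negbT/asboolPn//]; apply/negbTE/asboolPn.
  by apply: fdef_ext (dQ j) => v; split => [h|/asboolP//]; apply/asboolP.
apply: fdef_ext (fdef_all H) => v; split => [h|<- j]; last by rewrite ffunE.
by apply/ffunP => j; rewrite ffunE.
Qed.

(** The formula is a finite disjunction over the values of [f]. *)
Lemma fdef_bigcup n (J : finType) (f : ('I_n -> M) -> J)
    (Q : J -> ('I_n -> M) -> Prop) :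
  (forall j, fdef (fun v => f v = j)) -> (forall j, fdef (Q j)) ->
  fdef (fun v => Q (f v) v).
Proof.
move=> df dQ; apply: fdef_ext (fdef_any (fun j => fdef_and (df j) (dQ j))) => v.
by split=> [[j [->]]//|h]; exists (f v).
Qed.

(* A term of sort B as a formula whose variables of sort B are propositional
   variables. *)
Fixpoint bsem m n (v : 'I_m -> M) (z : 'I_n -> Prop) (t : bterm L m n) : Prop :=
  match t with
  | BVar j => z j
  | BEv k phi s => sat phi (fun i => v (s i))
  | BTop => True
  | BBot => False
  | BMeet s t => bsem v z s /\ bsem v z t
  | BJoin s t => bsem v z s \/ bsem v z t
  | BCompl s => ~ bsem v z s
  end.

Lemma fdef_bsem m n (z : 'I_n -> Prop) (t : bterm L m n) :
  fdef (fun v => bsem v z t).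
Proof.
elim: t => [j|k phi s| | |s ihs t iht|s ihs t iht|s ih] /=.
- exact: fdef_const.
- exact: (fdef_ren s (fdef_sat phi)).
- exact: fdef_const.
- exact: fdef_const.
- exact: fdef_and.
- exact: fdef_or.
- exact: fdef_not.
Qed.

Definition bdef m n (Q : ('I_m -> M) -> ('I_n -> Prop) -> Prop) :=
  exists t : bterm L m n, forall v z, bsem v z t <-> Q v z.

Lemma bdef_ext m n (Q Q' : ('I_m -> M) -> ('I_n -> Prop) -> Prop) :
  (forall v z, Q v z <-> Q' v z) -> bdef Q -> bdef Q'.
Proof. by move=> e [t h]; exists t => v z; rewrite h. Qed.

Lemma bdef_bsem m n (t : bterm L m n) : bdef (fun v z => bsem v z t).
Proof. by exists t. Qed.

Lemma bdef_fdef m n (Q : ('I_m -> M) -> Prop) :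
  fdef Q -> bdef (fun v (_ : 'I_n -> Prop) => Q v).
Proof. by move=> [phi h]; exists (BEv n phi id) => v z /=; rewrite h. Qed.

Lemma bdef_const m n (b : Prop) :
  bdef (fun (_ : 'I_m -> M) (_ : 'I_n -> Prop) => b).
Proof. exact/bdef_fdef/fdef_const. Qed.

Lemma bdef_not m n (Q : ('I_m -> M) -> ('I_n -> Prop) -> Prop) :
  bdef Q -> bdef (fun v z => ~ Q v z).
Proof. by move=> [t h]; exists (BCompl t) => v z /=; rewrite h. Qed.

Lemma bdef_and m n (Q Q' : ('I_m -> M) -> ('I_n -> Prop) -> Prop) :
  bdef Q -> bdef Q' -> bdef (fun v z => Q v z /\ Q' v z).
Proof.
by move=> [s h] [t h']; exists (BMeet s t) => v z /=; rewrite h h'.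
Qed.

Lemma bdef_all m n (J : finType)
    (Q : J -> ('I_m -> M) -> ('I_n -> Prop) -> Prop) :
  (forall j, bdef (Q j)) -> bdef (fun v z => forall j, Q j v z).
Proof.
move=> dQ; have H (l : seq J) : bdef (fun v z => forall j, j \in l -> Q j v z).
  elim: l => [|j l ih]; first by apply: bdef_ext (@bdef_const m n True).
  apply: bdef_ext (bdef_and (dQ j) ih) => v z; split => [[h h'] k|h].
    by rewrite inE => /orP[/eqP ->//|/h'].
  by split => [|k kl]; apply: h; rewrite inE ?eqxx// kl orbT.
apply: bdef_ext (H (enum J)) => v z; split => [h j|h j _]; last exact: h.
by apply: h; rewrite mem_enum.
Qed.

Lemma bdef_any m n (J : finType)
    (Q : J -> ('I_m -> M) -> ('I_n -> Prop) -> Prop) :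
  (forall j, bdef (Q j)) -> bdef (fun v z => exists j, Q j v z).
Proof.
move=> dQ; have := bdef_not (bdef_all (fun j => bdef_not (dQ j))).
by apply: bdef_ext => v z; split => [/existsNP[j /contrapT]|[j Qj] /(_ j)//]; exists j.
Qed.

Lemma bdef_iff m n (Q : ('I_m -> M) -> ('I_n -> Prop) -> Prop) (b : bool) :
  bdef Q -> bdef (fun v z => `[< Q v z >] = b).
Proof.
case: b => dQ; last first.
  apply: bdef_ext (bdef_not dQ) => v z.
  by split => [h|/negbT/asboolPn//]; apply/negbTE/asboolPn.
by apply: bdef_ext dQ => v z; split => [h|/asboolP//]; apply/asboolP.
Qed.

Lemma bdef_ffun m n (J : finType)
    (Q : J -> ('I_m -> M) -> ('I_n -> Prop) -> Prop) (p : {ffun J -> bool}) :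
  (forall j, bdef (Q j)) -> bdef (fun v z => [ffun j => `[< Q j v z >]] = p).
Proof.
move=> dQ; have := bdef_all (fun j => bdef_iff (p j) (dQ j)).
apply: bdef_ext => v z; split => [h|<- j]; last by rewrite ffunE.
by apply/ffunP => j; rewrite ffunE.
Qed.

Lemma asbool_ffunP n (z : 'I_n -> Prop) (b : {ffun 'I_n -> bool}) :
  (fun j => b j : Prop) = z <-> [ffun j => `[< z j >]] = b.
Proof.
split => [<-|<-].
  by apply/ffunP => j; rewrite ffunE asboolb.
by apply/funext => j; rewrite ffunE asboolE.
Qed.

(** A quantifier can occur only inside a first order formula, where event variables cannot. So the
    finitely many truth assignments [b] of [z] are distinguished, and in each case the quantified
    formula has constants in their place. *)
Lemma bdef_exK m n (Q : ('I_m.+1 -> M) -> ('I_n -> Prop) -> Prop) :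
  bdef Q -> bdef (fun v z => exists a, Q (scons a v) z).
Proof.
move=> [t h].
have : bdef (fun v (z : 'I_n -> Prop) => exists b : {ffun 'I_n -> bool},
    [ffun j => `[< z j >]] = b /\ exists a, bsem (scons a v) (fun j => b j) t).
  apply: bdef_any => b; apply: bdef_and; last first.
    exact/bdef_fdef/(fdef_ex (fdef_bsem _ t)).
  by apply: (@bdef_ffun m n 'I_n (fun j v z => z j)) => j; exists (BVar L m j).
apply: bdef_ext => v z; split => [[b [/asbool_ffunP bz [a]]]|[a Qa]].
  by rewrite bz h; exists a.
exists [ffun j => `[< z j >]]; split => //; exists a.
by rewrite ((asbool_ffunP z _).2 erefl) h.
Qed.

Lemma bdef_substB m n (Q : ('I_m -> M) -> ('I_n.+1 -> Prop) -> Prop) (b : Prop) :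
  bdef Q -> bdef (fun v z => Q v (scons b z)).
Proof.
move=> [t h]; apply: (@bdef_ext _ _ (fun v z => bsem v (scons b z) t)).
  by move=> v z; rewrite h.
elim: t {Q h} => [j|k phi s| | |s ihs t iht|s ihs t iht|s ih] /=.
- elim/scons_ind: j => [|j].
    by apply: bdef_ext (@bdef_const m n b) => v z; rewrite scons0.
  by exists (BVar L m j) => v z; rewrite sconsS.
- exact/bdef_fdef/(fdef_ren s (fdef_sat phi)).
- exact: bdef_const.
- exact: bdef_const.
- exact: bdef_and.
- have := bdef_not (bdef_and (bdef_not ihs) (bdef_not iht)).
  by apply: bdef_ext => v z; rewrite not_andE !notK.
- exact: bdef_not.
Qed.

Definition bpat (J : finType) m n (S : J -> bterm L m n) (v : 'I_m -> M)
    (z : 'I_n -> Prop) : {ffun J -> bool} :=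
  [ffun j => `[< bsem v z (S j) >]].

Lemma bdef_bpat (J : finType) m n (S : J -> bterm L m n) (p : {ffun J -> bool}) :
  bdef (fun v z => bpat S v z = p).
Proof. by apply: bdef_ffun => j; exact: bdef_bsem. Qed.

Lemma fdef_bpat (J : finType) m n (S : J -> bterm L m n) z (p : {ffun J -> bool}) :
  fdef (fun v => bpat S v z = p).
Proof. by have [t h] := bdef_bpat S p; apply: fdef_ext (fdef_bsem z t). Qed.

End Definability.

(** * Connectives, suprema and compact sets *)

Section RealFacts.
Variable R : realType.

Lemma sup_range_dist (X : Type) (x0 : X) (f g : X -> R) (e : R) :
  (forall x, f x <= 1) -> (forall x, g x <= 1) ->
  (forall x, exists y, `|f x - g y| <= e) ->
  (forall x, exists y, `|g x - f y| <= e) ->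
  `|sup (range f) - sup (range g)| <= e.
Proof.
have H (f' g' : X -> R) : (forall x, g' x <= 1) ->
    (forall x, exists y, `|f' x - g' y| <= e) ->
    sup (range f') <= sup (range g') + e.
  move=> g1 fg; apply: ge_sup; first by exists (f' x0), x0.
  move=> _ [x _ <-]; have [y /ler_normlP[_ xy]] := fg x.
  have : g' y <= sup (range g').
    by apply: ub_le_sup; [exists 1 => _ [z _ <-]|exists y].
  lra.
by move=> f1 g1 fg gf; apply/ler_normlP; split; rewrite ?opprB lerBlDl; exact: H.
Qed.

Lemma inf_range_dist (X : Type) (x0 : X) (f g : X -> R) (e : R) :
  (forall x, 0 <= f x) -> (forall x, 0 <= g x) ->
  (forall x, exists y, `|f x - g y| <= e) ->
  (forall x, exists y, `|g x - f y| <= e) ->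
  `|inf (range f) - inf (range g)| <= e.
Proof.
have H (f' g' : X -> R) : (forall x, 0 <= f' x) ->
    (forall x, exists y, `|g' x - f' y| <= e) ->
    inf (range f') - e <= inf (range g').
  move=> f0 gf; apply: lb_le_inf; first by exists (g' x0), x0.
  move=> _ [x _ <-]; have [y /ler_normlP[xy _]] := gf x.
  have : inf (range f') <= f' y.
    by apply: ge_inf; [exists 0 => _ [z _ <-]|exists y].
  lra.
by move=> f0 g0 fg gf; apply/ler_normlP; split;
  rewrite ?opprB lerBlDr -lerBlDl; exact: H.
Qed.

Lemma cube_compact k : compact (@cube R k).
Proof.
rewrite (_ : @cube R k = [set v | forall i, `[0, 1]%classic (v ord0 i)]).
  by apply: (@rV_compact R k (fun=> `[0, 1]%classic)) => i; exact: segment_compact.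
by apply/seteqP; split => v /= h i; have := h i; rewrite in_itv.
Qed.

(** Compactness of the cube in its near-covering form: a radius [r] that is good at [x] for [e / 2]
    serves all points within [r / 2] of [x] and all [dl < r / 2]. *)
Lemma connective_unif_continuous k (u : connective R k) (e : R) : 0 < e ->
  exists2 dl, 0 < dl & forall x x', @cube R k x -> @cube R k x' ->
    (forall i, `|x 0 i - x' 0 i| <= dl) -> `|u x - u x'| <= e.
Proof.
move=> e0; have /compact_near_coveringP cc := @cube_compact k.
pose Pr (dl : R) (x : 'rV[R]_k) := @cube R k x -> forall x', @cube R k x' ->
  (forall i, `|x 0 i - x' 0 i| <= dl) -> `|u x - u x'| <= e.
have uc := (subspace_continuousP _ _).1 (@conn_continuous R k u).
have := cc R 0^'+ Pr _; case.
  move=> x cx; have e20 : 0 < e / 2 by lra.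
  have /cvgrPdist_lt/(_ _ e20) := uc x cx.
  rewrite near_withinE => /nbhs_ballP[r /= r0 xr].
  have r20 : 0 < r / 2 by lra.
  exists (ball x (r / 2), [set dl | dl < r / 2]) => /=.
    by split; [exact: nbhsx_ballx|exact: nbhs_right_lt].
  move=> [y dl] /= [[_ xy] dr] cy x' cx' yx'.
  have h1 : `|u x - u y| < e / 2.
    apply: xr => //; split => // i j; apply: le_ball (xy i j); lra.
  have h2 : `|u x - u x'| < e / 2.
    apply: xr => //; split => // i j; have := xy i j; rewrite /ball/= (ord1 i).
    move=> h; have h' := yx' j.
    rewrite -(subrKA (y 0 j)); apply: le_lt_trans (ler_normD _ _) _; lra.
  have := ler_distD (u x) (u y) (u x'); rewrite (distrC (u y) (u x)); lra.
move=> dl /= dl0 h.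
exists (dl / 2); first by lra.
move=> x x' cx cx' xx'; apply: (h (dl / 2)) => //=; try lra.
by rewrite sub0r normrN gtr0_norm; lra.
Qed.

Lemma inv_succ_le (e : R) : 0 < e ->
  exists k0 : nat, forall k, (k0 <= k)%N -> k.+1%:R^-1 <= e.
Proof.
move=> e0; exists (Num.truncn e^-1) => k kk.
rewrite invf_ple ?posrE// ltW//; apply: lt_le_trans (truncnS_gt _) _.
by rewrite ler_nat.
Qed.

Lemma mdist_diff (X : metricType R) (x a b : X) :
  `|mdist x a - mdist x b| <= mdist b a.
Proof.
have := metric_triangle x a b; have := metric_triangle x b a.
by rewrite (metric_sym a b) => h1 h2; apply/ler_normlP; split; lra.
Qed.

Section Compactness.
Variables (X : metricType R) (C : set X).

Lemma compact_not_separated (c : nat -> X) (e : R) : 0 < e -> compact C ->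
  (forall n, C (c n)) -> (forall m n, (m < n)%N -> e <= mdist (c n) (c m)) ->
  False.
Proof.
move=> e0 cC Cc sep.
have [|p [Cp clp]] := cC (c x @[x --> \oo]) _.
  by exists 0%N => // n _; exact: Cc.
have e20 : 0 < e / 2 by lra.
have next n : exists2 k, (n <= k)%N & mdist p (c k) < e / 2.
  have [||_ [[k nk <-] h]] := clp (c @` [set k | (n <= k)%N]) (ball p (e / 2)).
  - by exists n => // k /= nk; exists k.
  - exact: nbhsx_ballx.
  by exists k => //; move: h; rewrite ballEmdist.
have [k _ hk] := next 0%N; have [l kl hl] := next k.+1.
have := sep _ _ kl; have := metric_triangle (c l) p (c k).
rewrite (metric_sym (c l) p); lra.
Qed.

Lemma dist_to_le (x c : X) : C c -> dist_to C x <= mdist x c.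
Proof.
move=> Cc; apply: ge_inf; last by exists c.
by exists 0 => _ [y _ <-]; exact: mdist_ge0.
Qed.

Lemma dist_to_near (x c : X) (e : R) : C c -> dist_to C x < e ->
  exists2 y, C y & mdist x y < e.
Proof.
move=> Cc lt; have ne : [set mdist x y | y in C] !=set0 by exists (mdist x c), c.
by have [_ [y Cy <-]] := inf_lt ne lt; exists y.
Qed.

(** As [b] lies in [C], each [f (c n)] is at most [2 * e], so [c n] is at distance at most [3 * e]
    from [C]. Moving two points into [C], by less than [4 * e] each, costs [8 * e] of their
    separation; what is left contradicts compactness. *)
Lemma compact_definable_not_separated (f : X -> R) (b : X) (c : nat -> X)
    (e dl : R) :
  0 < e -> 8 * e < dl -> compact C -> C b ->
  (forall x, `|f x - dist_to C x| <= e) ->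
  (forall n, `|f b - f (c n)| <= e) ->
  (forall m n, (m < n)%N -> dl <= mdist (c n) (c m)) -> False.
Proof.
move=> e0 edl cC Cb fC fc sep.
have near_C n : exists2 y, C y & mdist (c n) y < 4 * e.
  apply: (@dist_to_near _ b) => //.
  have : dist_to C b <= 0 by rewrite -(mdistxx b); exact: dist_to_le.
  have /ler_normlP[_ h1] := fC b; have /ler_normlP[h2 _] := fC (c n).
  have /ler_normlP[h3 _] := fc n; lra.
have /choice[p pP] : forall n, exists y, C y /\ mdist (c n) y < 4 * e.
  by move=> n; have [y] := near_C n; exists y.
apply: (@compact_not_separated p (dl - 8 * e)) => //; first by lra.
  by move=> n; have [] := pP n.
move=> m n mn; have [_ hm] := pP m; have [_ hn] := pP n.
have := sep _ _ mn; have := metric_triangle (c n) (p n) (c m).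
have := metric_triangle (p n) (p m) (c m).
rewrite (metric_sym (p m)); lra.
Qed.

Lemma dist_to1 (x c : X) : dist_to [set c] x = mdist x c.
Proof. by rewrite /dist_to image_set1 inf1. Qed.

End Compactness.

End RealFacts.

(** * The randomization *)

Section Randomization.
Context (R : realType) (L : language) (T : theory L) (M : structure L)
  (d : measure_display) (Om : measurableType d) (P : probability Om R)
  (K : set (Om -> M)) (N : rstructure L R)
  (qK : (Om -> M) -> KS N) (qB : set Om -> BS N).
Hypotheses (psP : is_prestructure P K) (qP : is_quotient P K qK qB)
  (trP : models_TR T N).

Let atl : atomless P := ps_atomless psP.
Let msP := tr_metric trP.
Local Notation pr := (prob P).

Lemma K_nonempty : exists a, K a.
Proof.
have [a Ka _] := ps_full psP (FEq (Var L ord0) (Var L ord0))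
  (b := @nilv (Om -> M)) (fun i => False_ind _ (notF (ltn_ord i))).
by exists a.
Qed.

Lemma K_lift n (x : 'I_n -> KS N) :
  exists2 a : 'I_n -> Om -> M, forall i, K (a i) & forall i, qK (a i) = x i.
Proof.
have /choice[a aP] : forall i, exists a, K a /\ qK a = x i.
  by move=> i; have [a] := q_surjK qP (x i); exists a.
by exists a => i; have [] := aP i.
Qed.

Lemma B_lift n (y : 'I_n -> BS N) :
  exists2 B : 'I_n -> set Om, forall j, measurable (B j)
  & forall j, qB (B j) = y j.
Proof.
have /choice[B BP] : forall j, exists B, measurable B /\ qB B = y j.
  by move=> j; have [B] := q_surjB qP (y j); exists B.
by exists B => j; have [] := BP j.
Qed.

Lemma rmu_q (A : set Om) : measurable A -> rmu (qB A) = pr A.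
Proof. by move=> mA; rewrite /prob -(q_mu qP mA). Qed.

Lemma mdist_qK a b : K a -> K b -> mdist (qK a) (qK b) = pr [set w | a w <> b w].
Proof. by move=> Ka Kb; rewrite /prob -(q_distK qP Ka Kb). Qed.

Lemma mdist_qB A B : measurable A -> measurable B ->
  mdist (qB A) (qB B) = pr ((A `\` B) `|` (B `\` A)).
Proof. by move=> mA mB; rewrite /prob -(q_distB qP mA mB). Qed.

(** * Terms of sort B as measurable sets *)

Section Events.
Variables (m n : nat) (a : 'I_m -> Om -> M) (B : 'I_n -> set Om).
Hypotheses (Ka : forall i, K (a i)) (mB : forall j, measurable (B j)).

Local Notation at_ w := (fun i => a i w).
Local Notation Bt_ w := (fun j => B j w).

Lemma bval_qB (t : bterm L m n) :
  measurable [set w | bsem (at_ w) (Bt_ w) t] /\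
  bval (fun i => qK (a i)) (fun j => qB (B j)) t =
    qB [set w | bsem (at_ w) (Bt_ w) t].
Proof.
elim: t => [j|k phi s| | |s [ms es] t [mt et]|s [ms es] t [mt et]|s [ms es]] /=.
- by split; first exact: mB.
- by split; [exact: (ps_meas psP)|exact: (q_ev qP)].
- by split; [exact: measurableT|exact: (q_top qP)].
- by split; [exact: measurable0|exact: (q_bot qP)].
- by split; [exact: measurableI|rewrite es et (q_meet qP)].
- by split; [exact: measurableU|rewrite es et (q_join qP)].
- by split; [exact: measurableC|rewrite es (q_compl qP)].
Qed.

Lemma measurable_bdef (Q : ('I_m -> M) -> ('I_n -> Prop) -> Prop) :
  bdef Q -> measurable [set w | Q (at_ w) (Bt_ w)].
Proof.
move=> [t tQ]; rewrite (_ : mkset _ = [set w | bsem (at_ w) (Bt_ w) t]).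
  by have [] := bval_qB t.
by apply/seteqP; split => w /tQ.
Qed.

Lemma rmu_bval (t : bterm L m n) :
  rmu (bval (fun i => qK (a i)) (fun j => qB (B j)) t) =
    pr [set w | bsem (at_ w) (Bt_ w) t].
Proof. by have [mt ->] := bval_qB t; rewrite rmu_q. Qed.

Lemma fmeas_bdef (J : finType) (Q : J -> ('I_m -> M) -> ('I_n -> Prop) -> Prop) :
  (forall j, bdef (Q j)) ->
  fmeas (fun w => [ffun j => `[< Q j (at_ w) (Bt_ w) >]]).
Proof.
move=> dQ; apply: fmeas_ffun => j.
exact/fmeas_bool/measurable_bdef.
Qed.

Lemma fmeas_bpat (J : finType) (S : J -> bterm L m n) :
  fmeas (fun w => bpat S (at_ w) (Bt_ w)).
Proof.
exact: (@fmeas_bdef J (fun j v z => bsem v z (S j)) (fun j => bdef_bsem M (S j))).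
Qed.

End Events.

Lemma measurable_fdef m (a : 'I_m -> Om -> M) (Q : ('I_m -> M) -> Prop) :
  (forall i, K (a i)) -> fdef Q -> measurable [set w | Q (fun i => a i w)].
Proof.
move=> Ka [phi h]; rewrite (_ : mkset _ = event phi a).
  exact: (ps_meas psP).
by apply/seteqP; split => w /h.
Qed.

Lemma K_scons m (a : Om -> M) (b : 'I_m -> Om -> M) :
  K a -> (forall i, K (b i)) -> forall i, K (scons a b i).
Proof. by move=> Ka Kb; apply: scons_ind => [|i]; rewrite ?scons0 ?sconsS. Qed.

Lemma B_scons m (A : set Om) (B : 'I_m -> set Om) :
  measurable A -> (forall i, measurable (B i)) ->
  forall i, measurable (scons A B i).
Proof. by move=> mA mB; apply: scons_ind => [|i]; rewrite ?scons0 ?sconsS. Qed.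

Lemma q_scons m (a : Om -> M) (b : 'I_m -> Om -> M) :
  (fun i => qK (scons a b i)) = scons (qK a) (fun i => qK (b i)).
Proof. exact: scons_comp. Qed.

Lemma at_scons m (a : Om -> M) (b : 'I_m -> Om -> M) w :
  (fun i => scons a b i w) = scons (a w) (fun i => b i w).
Proof. by rewrite (scons_comp (fun f => f w)). Qed.

Lemma Bt_scons m (A : set Om) (B : 'I_m -> set Om) w :
  (fun i => scons A B i w) = scons (A w) (fun i => B i w).
Proof. by rewrite (scons_comp (fun f => f w)). Qed.

(** * Gluing and witnesses *)

(** Since [E] is itself an event [phi(c)], fullness applies to the formula saying that the value is
    [a] if [phi(c)] holds and [b] otherwise. It has exactly one realization at every point, so the
    witness is the glued function itself, not just almost surely. *)
Lemma glue_two (a b : Om -> M) (E : set Om) : K a -> K b -> measurable E ->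
  K (fun w => if `[< E w >] then a w else b w).
Proof.
move=> Ka Kb /(ps_event psP)[n [phi [c [Kc ->]]]].
(* The variables are, in this order, the value, [a], [b] and the tuple [c]. *)
pose s1 : 'I_n.+3 := lift ord0 ord0.
pose s2 : 'I_n.+3 := lift ord0 (lift ord0 ord0).
pose sh (i : 'I_n) : 'I_n.+3 := lift ord0 (lift ord0 (lift ord0 i)).
have dphi : fdef (fun v : 'I_n.+3 -> M => sat phi (fun i => v (sh i))).
  exact: (@fdef_ren L M _ _ sh (fun v => sat phi v) (fdef_sat M phi)).
have [th thP] := fdef_or (fdef_and dphi (fdef_eq _ ord0 s1))
  (fdef_and (fdef_not dphi) (fdef_eq _ ord0 s2)).
have Kb' := K_scons Ka (K_scons Kb Kc).
have [g Kg /seteqP[_ gex]] := ps_full psP th Kb'.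
have e1 u w : scons u (fun i => scons a (scons b c) i w) s1 = a w.
  by rewrite /s1 sconsS scons0.
have e2 u w : scons u (fun i => scons a (scons b c) i w) s2 = b w.
  by rewrite /s2 !sconsS scons0.
have e3 u w : (fun i => scons u (fun i => scons a (scons b c) i w) (sh i)) =
    (fun i => c i w).
  by apply/funext => i; rewrite /sh !sconsS.
rewrite (_ : (fun w => _) = g)//; apply/funext => w.
have : event (FEx th) (scons a (scons b c)) w.
  exists (if `[< event phi c w >] then a w else b w).
  rewrite thP scons0 e1 e2 e3.
  by case: asboolP => h; [left|right].
move=> /gex; rewrite /event/= at_scons thP scons0 e1 e2 e3.
by case: asboolP => h [[]|[]].
Qed.

Lemma glue (G : finType) (g : Om -> G) (a : G -> Om -> M) :
  fmeas g -> (forall x, K (a x)) -> K (fun w => a (g w) w).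
Proof.
move=> mg Ka; have [a0 Ka0] := K_nonempty.
have H (l : seq G) : K (fun w => if g w \in l then a (g w) w else a0 w).
  elim: l => [//|x l ih].
  rewrite (_ : (fun w => _) = fun w => if `[< (g @^-1` [set x]) w >] then a x w
      else if g w \in l then a (g w) w else a0 w).
    by apply: glue_two => //; exact: mg.
  apply/funext => w; rewrite inE; case: asboolP => /= [->|/eqP/negbTE ->//].
  by rewrite eqxx.
rewrite (_ : (fun w => _) = fun w => if g w \in enum G then a (g w) w else a0 w).
  exact: H.
by apply/funext => w; rewrite mem_enum.
Qed.

Lemma witness m (a : 'I_m -> Om -> M) (Q : ('I_m.+1 -> M) -> Prop) :
  (forall i, K (a i)) -> fdef Q ->
  exists2 u, K u & forall w, (exists x, Q (scons x (fun i => a i w))) ->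
    Q (scons (u w) (fun i => a i w)).
Proof.
move=> Ka [th thQ]; have [u Ku /seteqP[_ uex]] := ps_full psP th Ka.
exists u => // w [x Qx]; rewrite -thQ -at_scons; apply: uex.
by exists x; rewrite thQ.
Qed.

(** Fullness concerns formulas without event variables, so a witness is taken for each truth
    assignment [b] of the events, and the witnesses are glued along the actual assignment. *)
Lemma bwitness m n (a : 'I_m -> Om -> M) (B : 'I_n -> set Om)
    (Q : ('I_m.+1 -> M) -> ('I_n -> Prop) -> Prop) :
  (forall i, K (a i)) -> (forall j, measurable (B j)) -> bdef Q ->
  exists2 u, K u & forall w,
    (exists x, Q (scons x (fun i => a i w)) (fun j => B j w)) ->
    Q (scons (u w) (fun i => a i w)) (fun j => B j w).
Proof.
move=> Ka mB [t tQ].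
have /choice[u uP] : forall b : {ffun 'I_n -> bool}, exists u, K u /\
    forall w, (exists x, bsem (scons x (fun i => a i w)) (fun j => b j) t) ->
      bsem (scons (u w) (fun i => a i w)) (fun j => b j) t.
  by move=> b; have [u Ku h] := witness Ka (fdef_bsem M (fun j => b j) t); exists u.
pose g w : {ffun 'I_n -> bool} := [ffun j => `[< B j w >]].
have mg : fmeas g by apply: fmeas_ffun => j; exact: fmeas_bool.
exists (fun w => u (g w) w).
  by apply: glue => // b; have [] := uP b.
move=> w [x Qx]; have [_ h] := uP (g w); rewrite -tQ.
have <- : (fun j => g w j : Prop) = (fun j => B j w) by exact/asbool_ffunP.
by apply: h; exists x; rewrite (asbool_ffunP (fun j => B j w) _).2// tQ.
Qed.

(** * Back-and-forth on laws and approximate quantifier elimination *)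

Definition bagree (J : Type) m n (S : J -> bterm L m n)
    (x : 'I_m -> KS N) (y : 'I_n -> BS N) (x' : 'I_m -> KS N)
    (y' : 'I_n -> BS N) :=
  forall j, rmu (bval x y (S j)) = rmu (bval x' y' (S j)).

Lemma bagree_sym (J : Type) m n (S : J -> bterm L m n) x y x' y' :
  bagree S x y x' y' -> bagree S x' y' x y.
Proof. by move=> h j; rewrite h. Qed.

(* [S'] says which truth patterns of [S] are realized by some value of the new
   variable; patterns of the right law are then drawn and glued from witnesses. *)
Lemma extend_K (J : finType) m n (S : J -> bterm L m.+1 n) :
  exists (J' : finType) (S' : J' -> bterm L m n), forall x y x' y',
    bagree S' x y x' y' ->
    forall a, exists a', bagree S (scons a x) y (scons a' x') y'.
Proof.
pose G := {ffun J -> bool}.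
pose Q (p : G) (v : 'I_m -> M) (z : 'I_n -> Prop) :=
  exists u, bpat S (scons u v) z = p.
have dQ p : bdef (Q p) by exact: bdef_exK (bdef_bpat _ S p).
pose tp v z : {ffun G -> bool} := [ffun p => `[< Q p v z >]].
(* There is one term for each possible set [t] of realizable patterns, so agreement on [S'] means
   that [F] and [F'] below have the same law. *)
have /choice[S' S'P] : forall t : {ffun G -> bool}, exists s : bterm L m n,
    forall v z, bsem v z s <-> tp v z = t by move=> t; exact: bdef_ffun.
exists {ffun G -> bool}, S' => x y x' y'.
have [xr Kx /funext <-] := K_lift x; have [x'r Kx' /funext <-] := K_lift x'.
have [yr my /funext <-] := B_lift y; have [y'r my' /funext <-] := B_lift y'.
move=> agr a0; have [a Ka <-] := q_surjK qP a0.
pose F w := tp (fun i => xr i w) (fun j => yr j w).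
pose F' w := tp (fun i => x'r i w) (fun j => y'r j w).
have mF : fmeas F by exact: (fmeas_bdef Kx my dQ).
have mF' : fmeas F' by exact: (fmeas_bdef Kx' my' dQ).
have FF' t : pr (F @^-1` [set t]) = pr (F' @^-1` [set t]).
  have := agr t; rewrite !rmu_bval// => e.
  rewrite (_ : F @^-1` _ = [set w | bsem (fun i => xr i w) (fun j => yr j w) (S' t)]).
    by rewrite e; congr pr; apply/seteqP; split => w /S'P.
  by apply/seteqP; split => w /S'P.
have Kax := K_scons Ka Kx.
pose p w := bpat S (fun i => scons a xr i w) (fun j => yr j w).
have mp : fmeas p by exact: (fmeas_bpat Kax my S).
(* The pattern [q] is drawn so that [(F', q)] has the law of [(F, p)]. *)
have [q [mq qw]] := @atomless_joint_law _ _ _ P atl _ _ F'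
  (fun t s => pr (F @^-1` [set t] `&` p @^-1` [set s])) mF'
  (fun _ _ => pr_ge0 P _)
  (fun t => etrans (pr_joint_sum P t mF mp) (FF' t)).
have /choice[u uP] : forall s : G, exists u, K u /\
    forall w, (exists z, bpat S (scons z (fun i => x'r i w)) (fun j => y'r j w) = s) ->
      bpat S (scons (u w) (fun i => x'r i w)) (fun j => y'r j w) = s.
  move=> s; have [u Ku h] := bwitness Kx' my' (bdef_bpat _ S s).
  by exists u.
pose a' w := u (q w) w.
have Ka' : K a' by apply: glue => // s; have [] := uP s.
exists (qK a'); rewrite -!q_scons => j; rewrite !rmu_bval//; last exact: K_scons.
pose p' w := bpat S (fun i => scons a' x'r i w) (fun j => y'r j w).
have mp' : fmeas p' by exact: (fmeas_bpat (K_scons Ka' Kx') my' S).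
(* Here the drawn pattern has no realization. This set is null because the pattern [p] always has
   one, namely [a]. *)
pose E := [set w | ~~ F' w (q w)].
have mF'q := fmeas_pair mF' mq.
have mE : measurable E.
  exact: (fmeas_set [set z : {ffun G -> bool} * G | ~~ z.1 z.2] mF'q).
have E0 : pr E = 0.
  have -> := pr_sum_in P [pred z : {ffun G -> bool} * G | ~~ z.1 z.2] mF'q.
  apply: big1 => -[t s] /= ts.
  rewrite (_ : _ @^-1` _ = F' @^-1` [set t] `&` q @^-1` [set s]).
    rewrite qw (_ : _ `&` _ = set0) ?pr0//.
    apply/seteqP; split => w //= [Ft ps]; move: ts; rewrite inE /= -Ft ffunE.
    by move=> /asboolPn; apply; exists (a w); rewrite -at_scons.
  by apply/seteqP; split => w /= [-> ->].
have pq w : ~ E w -> p' w = q w.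
  move=> /negP; rewrite negbK ffunE => /asboolP h.
  have [_ /(_ w h) e] := uP (q w).
  by rewrite /p' at_scons.
have pp' s : pr (p @^-1` [set s]) = pr (p' @^-1` [set s]).
  rewrite (@pr_eq_off_null _ _ _ P (p' @^-1` [set s]) (q @^-1` [set s]) E)//.
  - rewrite (pr_sum P mF' (mq s)) (pr_sum P mF (mp s)).
    by apply: eq_bigr => t _; rewrite setIC -qw setIC.
  - by move=> w /pq /= ->.
have := pr_same_law [pred s : G | s j] mp mp' pp'.
by congr (pr _ = pr _); apply/seteqP; split => w /=; rewrite inE /= ffunE => /asboolP.
Qed.

Lemma extend_B (J : finType) m n (S : J -> bterm L m n.+1) :
  exists (J' : finType) (S' : J' -> bterm L m n), forall x y x' y',
    bagree S' x y x' y' ->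
    forall b, exists b', bagree S x (scons b y) x' (scons b' y').
Proof.
pose Q (jb : J * bool) (v : 'I_m -> M) (z : 'I_n -> Prop) :=
  bsem v (scons (jb.2 : Prop) z) (S jb.1).
have dQ jb : bdef (Q jb)
  by exact: (bdef_substB (jb.2 : Prop) (bdef_bsem M (S jb.1))).
pose tp v z : {ffun J * bool -> bool} := [ffun jb => `[< Q jb v z >]].
have /choice[S' S'P] : forall t : {ffun J * bool -> bool}, exists s : bterm L m n,
    forall v z, bsem v z s <-> tp v z = t by move=> t; exact: bdef_ffun.
exists {ffun J * bool -> bool}, S' => x y x' y'.
have [xr Kx /funext <-] := K_lift x; have [x'r Kx' /funext <-] := K_lift x'.
have [yr my /funext <-] := B_lift y; have [y'r my' /funext <-] := B_lift y'.
move=> agr b0; have [B mB <-] := q_surjB qP b0.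
pose F w := tp (fun i => xr i w) (fun j => yr j w).
pose F' w := tp (fun i => x'r i w) (fun j => y'r j w).
have mF : fmeas F by exact: (fmeas_bdef Kx my dQ).
have mF' : fmeas F' by exact: (fmeas_bdef Kx' my' dQ).
have FF' t : pr (F @^-1` [set t]) = pr (F' @^-1` [set t]).
  have := agr t; rewrite !rmu_bval// => e.
  rewrite (_ : F @^-1` _ = [set w | bsem (fun i => xr i w) (fun j => yr j w) (S' t)]).
    by rewrite e; congr pr; apply/seteqP; split => w /S'P.
  by apply/seteqP; split => w /S'P.
pose p w := `[< B w >].
have mp : fmeas p by exact: fmeas_bool.
have [q [mq qw]] := @atomless_joint_law _ _ _ P atl _ _ F'
  (fun t s => pr (F @^-1` [set t] `&` p @^-1` [set s])) mF'
  (fun _ _ => pr_ge0 P _)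
  (fun t => etrans (pr_joint_sum P t mF mp) (FF' t)).
pose B' := [set w | q w].
have mB' : measurable B' by exact: (fmeas_set [set s : bool | s] mq).
exists (qB B'); rewrite -!(scons_comp qB) => j; rewrite !rmu_bval//; try exact: B_scons.
have h := @pr_same_law _ _ _ P _ (fun w => (F w, p w)) (fun w => (F' w, q w))
  [pred z : {ffun J * bool -> bool} * bool | z.1 (j, z.2)]
  (fmeas_pair mF mp) (fmeas_pair mF' mq).
have {}h : pr [set w | F w (j, p w)] = pr [set w | F' w (j, q w)].
  apply: h => -[t s].
  rewrite (_ : _ @^-1` _ = F @^-1` [set t] `&` p @^-1` [set s]).
    rewrite -qw; congr pr.
    by apply/seteqP; split => w /= [-> ->].
  by apply/seteqP; split => w /= [-> ->].
move: h; congr (pr _ = pr _); apply/seteqP; split => w /=; rewrite ffunE Bt_scons.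
- by move=> /asboolP; rewrite /Q /= asboolE.
- by move=> h; apply/asboolP; rewrite /Q /= asboolE.
- by move=> /asboolP.
- by move=> h; apply/asboolP.
Qed.

(** The suprema and infima thus range over bounded sets, and connectives are evaluated in the cube,
    where they are controlled. *)
Lemma cval_bnd m n (phi : cform L R m n) (x : 'I_m -> KS N) (y : 'I_n -> BS N) :
  0 <= cval phi x y <= 1.
Proof.
have [k0 _] := K_nonempty.
elim: phi x y => {m n} [m n s|m n i j|m n s t|m n k u phi ih|m n phi ih|m n phi ih
  |m n phi ih|m n phi ih] x y /=.
- exact: (ms_mu_bnd msP).
- by rewrite mdist_ge0 (ms_diamK msP).
- by rewrite mdist_ge0 (ms_diamB msP).
- by apply: conn_bnd => i; rewrite mxE.
- have h z : 0 <= cval phi (scons z x) y <= 1 by exact: ih.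
  apply/andP; split; last first.
    by apply: ge_sup; [exists (cval phi (scons (qK k0) x) y), (qK k0)|
      move=> _ [z _ <-]; have /andP[] := h z].
  have /andP[h0 h1] := h (qK k0); apply: le_trans h0 _; apply: ub_le_sup.
    by exists 1 => _ [z _ <-]; have /andP[] := h z.
  by exists (qK k0).
- have h z : 0 <= cval phi (scons z x) y <= 1 by exact: ih.
  apply/andP; split.
    by apply: lb_le_inf; [exists (cval phi (scons (qK k0) x) y), (qK k0)|
      move=> _ [z _ <-]; have /andP[] := h z].
  have /andP[h0 h1] := h (qK k0); apply: le_trans h1; apply: ge_inf.
    by exists 0 => _ [z _ <-]; have /andP[] := h z.
  by exists (qK k0).
- have h z : 0 <= cval phi x (scons z y) <= 1 by exact: ih.
  apply/andP; split; last first.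
    by apply: ge_sup; [exists (cval phi x (scons (btop N) y)), (btop N)|
      move=> _ [z _ <-]; have /andP[] := h z].
  have /andP[h0 h1] := h (btop N); apply: le_trans h0 _; apply: ub_le_sup.
    by exists 1 => _ [z _ <-]; have /andP[] := h z.
  by exists (btop N).
- have h z : 0 <= cval phi x (scons z y) <= 1 by exact: ih.
  apply/andP; split.
    by apply: lb_le_inf; [exists (cval phi x (scons (btop N) y)), (btop N)|
      move=> _ [z _ <-]; have /andP[] := h z].
  have /andP[h0 h1] := h (btop N); apply: le_trans h1; apply: ge_inf.
    by exists 0 => _ [z _ <-]; have /andP[] := h z.
  by exists (btop N).
Qed.

(* An approximate form of quantifier elimination. *)
Lemma cval_determined m n (phi : cform L R m n) (e : R) : 0 < e ->
  exists (J : finType) (S : J -> bterm L m n), forall x y x' y',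
    bagree S x y x' y' -> `|cval phi x y - cval phi x' y'| <= e.
Proof.
have [k0 _] := K_nonempty.
elim: phi e => {m n} [m n s|m n i j|m n s t|m n k u phi ih|m n phi ih|m n phi ih
  |m n phi ih|m n phi ih] e e0 /=.
- by exists unit, (fun=> s) => x y x' y' /(_ tt) ->; rewrite subrr normr0 ltW.
- exists unit, (fun=> BEv n (eq01 L) (pairv i j)) => x y x' y' /(_ tt) /=.
  rewrite !(tr_distK trP).
  have ep (z : 'I_m -> KS N) : (fun k => z (pairv i j k)) = pairv (z i) (z j).
    by rewrite /pairv !scons_comp; congr (scons _ (scons _ _)); apply/funext => -[].
  by rewrite !ep => ->; rewrite subrr normr0 ltW.
- exists unit, (fun=> BJoin (BMeet s (BCompl t)) (BMeet (BCompl s) t)).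
  by move=> x y x' y' /(_ tt) /=; rewrite !(tr_distB trP) /bsymdiff => ->;
    rewrite subrr normr0 ltW.
- have [dl dl0 uc] := connective_unif_continuous u e0.
  have /choice[J JP] : forall i, exists J : finType, exists S : J -> bterm L m n,
      forall x y x' y', bagree S x y x' y' ->
        `|cval (phi i) x y - cval (phi i) x' y'| <= dl.
    by move=> i; exact: ih.
  exists {i : 'I_k & J i}.
  pose S i := projT1 (cid (JP i)); have SP i := projT2 (cid (JP i)).
  exists (fun ij => S (tag ij) (tagged ij)) => x y x' y' agr.
  apply: uc => [i|i|i]; rewrite !mxE; [exact: cval_bnd|exact: cval_bnd|].
  by apply: SP => j; exact: (agr (Tagged J j)).
- have [J [S SP]] := ih e e0; have [J' [S' S'P]] := extend_K S.
  exists J', S' => x y x' y' agr; apply: (sup_range_dist (qK k0)) => z.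
  + by have /andP[] := cval_bnd phi (scons z x) y.
  + by have /andP[] := cval_bnd phi (scons z x') y'.
  + by have [z' /SP] := S'P _ _ _ _ agr z; exists z'.
  + by have [z' /SP] := S'P _ _ _ _ (bagree_sym agr) z; exists z'.
- have [J [S SP]] := ih e e0; have [J' [S' S'P]] := extend_K S.
  exists J', S' => x y x' y' agr; apply: (inf_range_dist (qK k0)) => z.
  + by have /andP[] := cval_bnd phi (scons z x) y.
  + by have /andP[] := cval_bnd phi (scons z x') y'.
  + by have [z' /SP] := S'P _ _ _ _ agr z; exists z'.
  + by have [z' /SP] := S'P _ _ _ _ (bagree_sym agr) z; exists z'.
- have [J [S SP]] := ih e e0; have [J' [S' S'P]] := extend_B S.
  exists J', S' => x y x' y' agr; apply: (sup_range_dist (btop N)) => z.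
  + by have /andP[] := cval_bnd phi x (scons z y).
  + by have /andP[] := cval_bnd phi x' (scons z y').
  + by have [z' /SP] := S'P _ _ _ _ agr z; exists z'.
  + by have [z' /SP] := S'P _ _ _ _ (bagree_sym agr) z; exists z'.
- have [J [S SP]] := ih e e0; have [J' [S' S'P]] := extend_B S.
  exists J', S' => x y x' y' agr; apply: (inf_range_dist (btop N)) => z.
  + by have /andP[] := cval_bnd phi x (scons z y).
  + by have /andP[] := cval_bnd phi x' (scons z y').
  + by have [z' /SP] := S'P _ _ _ _ agr z; exists z'.
  + by have [z' /SP] := S'P _ _ _ _ (bagree_sym agr) z; exists z'.
Qed.

(** * Algebraic closure in terms of events and definable partial functions *)

Definition ev_closure (X : set (KS N)) : set (BS N) :=
  [set E | forall e : R, 0 < e -> exists n (phi : form L n) (x : 'I_n -> KS N),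
    (forall i, X (x i)) /\ mdist E (ev phi x) <= e].

Definition functional n (th : form L n.+1) :=
  forall (v : 'I_n -> M) a b, sat th (scons a v) -> sat th (scons b v) -> a = b.

Definition dcl_closure (X : set (KS N)) : set (KS N) :=
  [set b | forall e : R, 0 < e -> exists n (th : form L n.+1) (x : 'I_n -> KS N),
    [/\ functional th, forall i, X (x i)
      & rmu (ev (FNot th) (scons b x)) <= e]].

Lemma measurable_neq a b : K a -> K b -> measurable [set w | a w <> b w].
Proof.
move=> Ka Kb.
have Kab : forall i, K (pairv a b i).
  by apply: K_scons => //; apply: K_scons => // -[].
have := measurable_fdef Kab (fdef_not (fdef_eq M ord0 (lift ord0 ord0))).
by congr measurable; apply/seteqP; split => w /=; rewrite /pairv sconsS !scons0.
Qed.

Lemma rmu_ev n (phi : form L n) (a : 'I_n -> Om -> M) : (forall i, K (a i)) ->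
  rmu (ev phi (fun i => qK (a i))) = pr (event phi a).
Proof. by move=> Ka; rewrite (q_ev qP)// rmu_q//; exact: (ps_meas psP). Qed.

Lemma rmu_ev_not n (phi : form L n) (a : 'I_n -> Om -> M) :
  (forall i, K (a i)) ->
  rmu (ev (FNot phi) (fun i => qK (a i))) = 1 - pr (event phi a).
Proof.
move=> Ka; rewrite rmu_ev// -(prT P) -prD//; last exact: (ps_meas psP).
by rewrite setTD.
Qed.

(** Where [th(b, x)] holds, [th(u, x)] holds exactly if [u = b]. So if [b] is nearly a value of [th]
    at [x], the measure of the failure of [th(u, x)] is nearly the distance from [u] to [b],
    uniformly in [u]. *)
Lemma functional_dist n (th : form L n.+1) (x : 'I_n -> KS N) u b :
  functional th ->
  `|rmu (ev (FNot th) (scons u x)) - mdist u b| <=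
    rmu (ev (FNot th) (scons b x)).
Proof.
move=> fth; have [xr Kx /funext <-] := K_lift x.
have [a Ka <-] := q_surjK qP u; have [c Kc <-] := q_surjK qP b.
rewrite -!q_scons !rmu_ev ?mdist_qK//; try exact: K_scons.
pose A v := event (FNot th) (scons v xr).
have AE v w : A v w <-> ~ sat th (scons (v w) (fun i => xr i w)).
  by rewrite /A /event/= at_scons.
have mA v : K v -> measurable (A v).
  by move=> Kv; apply: (ps_meas psP); exact: K_scons.
have mac := measurable_neq Ka Kc.
apply/ler_normlP; split.
  rewrite opprB lerBlDl; apply: le_trans (prU_le P (mA _ Ka) (mA _ Kc)).
  apply: prS => //; first exact: measurableU (mA _ Ka) (mA _ Kc).
  move=> w /= ac; apply: contrapT => /not_orP[/AE/contrapT h /AE/contrapT h'].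
  exact/ac/(fth _ _ _ h h').
rewrite lerBlDl; apply: le_trans (prU_le P mac (mA _ Kc)).
apply: prS; [exact: mA|exact: measurableU mac (mA _ Kc)|].
move=> w /AE Aa; have [ac|] := pselect (a w = c w); last by left.
by right; apply/AE; rewrite -ac.
Qed.

(** The singleton of [E] is the compact set: the distance to [E] is the uniform limit of the
    distances to the events [phi(x)]. *)
Lemma ev_closure_aclB (X : set (KS N)) : ev_closure X `<=` aclB X.
Proof.
move=> E EX; exists [set E]; split; [exact: compact_set1|by []|].
have /choice[f fP] : forall k : nat, exists f : pcform N 0 1,
    pc_over X set0 f /\ forall x y, `|pcval f x y - mdist (y ord0) E| <= k.+1%:R^-1.
  move=> k; have [n [phi [x [Xx xE]]]] := EX k.+1%:R^-1 (ltac:(by rewrite invr_gt0)).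
  exists (@PCForm L R N 0 1 n 0 (CDistB R (BVar L n ord0) (BEv 1 phi id)) x
    (@nilv (BS N))).
  split; first by split => // -[].
  move=> u y; rewrite /pcval /= fcat_nil.
  rewrite (_ : fcat y _ ord0 = y ord0); last first.
    rewrite /fcat (_ : ord0 = lshift 0 (ord0 : 'I_1)); last exact: val_inj.
    by rewrite (unsplitK (inl _)); congr y; exact: val_inj.
  change (`|mdist (y ord0) (ev phi x) - mdist (y ord0) E| <= k.+1%:R^-1).
  exact: le_trans (mdist_diff _ _ _) xE.
exists f; first by move=> k; have [] := fP k.
move=> e /inv_succ_le[k0 h]; exists k0 => k /h ke x y.
by rewrite dist_to1; have [_ /(_ x y) h'] := fP k; exact: le_trans ke.
Qed.

(** The compact set is again a singleton; the distance to [b] is the uniform limit of the measures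
    of failure of [th] at [x]. *)
Lemma dcl_closure_aclK (X : set (KS N)) : dcl_closure X `<=` aclK X.
Proof.
move=> b bX; exists [set b]; split; [exact: compact_set1|by []|].
have /choice[f fP] : forall k : nat, exists f : pcform N 1 0,
    pc_over X set0 f /\ forall x y, `|pcval f x y - mdist (x ord0) b| <= k.+1%:R^-1.
  move=> k; have [n [th [x [fth Xx xb]]]] := bX k.+1%:R^-1 (ltac:(by rewrite invr_gt0)).
  exists (@PCForm L R N 1 0 n 0 (CMu R (@BEv L n.+1 0 n.+1 (FNot th) id)) x
    (@nilv (BS N))).
  split; first by split => // -[].
  move=> u y; rewrite /pcval /=.
  rewrite (_ : u = fun=> u ord0); last by apply/funext => i; rewrite (ord1 i).
  have -> : (fun i => fcat (fun _ : 'I_1 => u ord0) x i) = scons (u ord0) x.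
    exact: fcat_scons.
  exact: le_trans (functional_dist _ _ _ fth) xb.
exists f; first by move=> k; have [] := fP k.
move=> e /inv_succ_le[k0 h]; exists k0 => k /h ke x y.
by rewrite dist_to1; have [_ /(_ x y) h'] := fP k; exact: le_trans ke.
Qed.

Lemma mdist_qB_iff (A B : set Om) : measurable A -> measurable B ->
  mdist (qB A) (qB B) = 1 - pr [set w | A w <-> B w].
Proof.
move=> mA mB; rewrite mdist_qB//.
have mAB : measurable ((A `\` B) `|` (B `\` A)).
  by apply: measurableU; exact: measurableD.
rewrite (_ : mkset _ = setT `\` ((A `\` B) `|` (B `\` A))).
  by rewrite prD// prT subKr.
apply/seteqP; split => w /=; first by tauto.
by move=> [_ h]; split => ?; apply: contrapT => ?; apply: h; [left|right].
Qed.

(** The copies have the law of [E] given [F], the table of truth values of the terms of [S] with the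
    event variable true or false. The joint law with [F] fixes the value of [psi] up to the error,
    so the copies are near [C], as [E] is in it. *)
Lemma aclB_ev_closure (X : set (KS N)) : aclB X `<=` ev_closure X.
Proof.
move=> E0 [C [cC CE [f fX fC]]] e e0; apply: contrapT => far_ev.
(* The copies will be [e] apart, and [8 * (e / 16) < e]. *)
have e160 : 0 < e / 16 by lra.
have [k0 /(_ k0 (leqnn _)) {}fC] := fC _ e160.
(* A formula over [X] and the empty set has no parameters of sort B. *)
case: (f k0) (fX k0) fC => p [|q] psi px py [/= Xp py0] /= fC; last first.
  by have := py0 ord0.
clear py0; have [J [S SP]] := cval_determined psi e160.
have [xr Kx xrE] := K_lift px; move/funext in xrE.
have [E mE EE] := q_surjB qP E0.
pose u0 : 'I_0 -> KS N := @nilv (KS N).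
pose Q (jb : J * bool) (v : 'I_p -> M) := bsem v (fun _ : 'I_(1 + 0) => jb.2 : Prop) (S jb.1).
have dQ jb : fdef (Q jb) by exact: fdef_bsem.
pose tp v : {ffun J * bool -> bool} := [ffun jb => `[< Q jb v >]].
have dtp t : fdef (fun v => tp v = t) by exact: fdef_ffun.
pose F w := tp (fun i => xr i w).
have mF : fmeas F by move=> t; exact: (measurable_fdef Kx (dtp t)).
pose q0 w := `[< E w >].
have mq0 : fmeas q0 by exact: fmeas_bool.
pose W t b := pr (F @^-1` [set t] `&` q0 @^-1` [set b]).
have eqsum (q : Om -> bool) (c : {ffun J * bool -> bool} -> bool) : fmeas q ->
    pr [set w | q w = c (F w)] =
      \sum_t pr (F @^-1` [set t] `&` q @^-1` [set c t]).
  move=> mq; rewrite (pr_sum P mF); last first.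
    exact: (fmeas_set [set z : bool * _ | z.1 = c z.2] (fmeas_pair mq mF)).
  apply: eq_bigr => t _; congr pr; apply/seteqP.
  by split => w /= [h1 h2]; split => //; rewrite ?h1 h2.
(* A guess [c (F w)] of the event is an event over [X], at distance more than [e] from [E0], so it
   is right with probability at most [1 - e]. *)
have Wle c : \sum_t W t (c t) <= 1 - e.
  have [th thP] := fdef_bigcup dtp (fun t => @fdef_const L M p (c t)).
  have mth : measurable (event th xr) by exact: (ps_meas psP).
  have : e < mdist E0 (ev th px).
    by rewrite ltNge; apply/negP => le; apply: far_ev; exists p, th, px.
  rewrite -xrE -EE (q_ev qP)// mdist_qB_iff// -eqsum//.
  rewrite (_ : [set w | E w <-> _] = [set w | q0 w = c (F w)]); first by lra.
  apply/seteqP; split => w /=; rewrite /event /= thP -/(F w) /q0.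
    by move=> h; apply/idP/idP => [/asboolP/h|/h/asboolP].
  by move=> <-; split => /asboolP.
have [q [mq qW qsep]] := independent_copies atl mF
  (fun _ _ => pr_ge0 P _ : 0 <= W _ _) (fun t => pr_joint_sum P t mF mq0) Wle.
pose B n := [set w | q n w].
have mB n : measurable (B n) by exact: (fmeas_set [set s : bool | s] (mq n)).
have fcatB (y : BS N) : fcat (fun _ : 'I_1 => y) py = fun=> y.
  by apply/funext => i; rewrite /fcat; case: fintype.split => // -[].
pose g y := cval psi (fcat u0 px) (fcat (fun _ : 'I_1 => y) py).
apply: (@compact_definable_not_separated R _ C g E0 (fun n => qB (B n))
  (e / 16) e) => //.
- by lra.
- by move=> y; exact: (fC u0 (fun=> y)).
- move=> n; apply: SP => j; rewrite !fcatB fcat_nil -xrE -EE.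
  have fj (A : set Om) : measurable A ->
      rmu (bval (fun i => qK (xr i)) (fun=> qB A) (S j)) =
      pr [set w | F w (j, `[< A w >])].
    move=> mA; rewrite (@rmu_bval p 1 xr (fun=> A))//; congr pr.
    have AE w : (fun _ : 'I_1 => `[< A w >] : Prop) = fun=> A w.
      by apply/funext => _; rewrite asboolE.
    by apply/seteqP; split => w /=; rewrite ffunE /Q /= AE => /asboolP.
  rewrite !fj//.
  have := @pr_same_law _ _ _ P _ (fun w => (F w, q0 w)) (fun w => (F w, q n w))
    [pred z : {ffun J * bool -> bool} * bool | z.1 (j, z.2)]
    (fmeas_pair mF mq0) (fmeas_pair mF (mq n)).
  rewrite (_ : [set w | F w (j, `[< B n w >])] = [set w | F w (j, q n w)]).
    apply=> -[t b].
    have pre (r : Om -> bool) : (fun w => (F w, r w)) @^-1` [set (t, b)] =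
        F @^-1` [set t] `&` r @^-1` [set b].
      by apply/seteqP; split => w /= [-> ->].
    by rewrite !pre qW.
  by apply/seteqP; split => w /=; rewrite asboolb.
- move=> m n mn; rewrite mdist_qB_iff//.
  have := qsep _ _ mn; rewrite (_ : [set w | B n w <-> B m w] =
    [set om | q n om = q m om]); first by lra.
  apply/seteqP; split => w; rewrite /B /=; first by move=> h; apply/idP/idP => /h.
  by move=> ->.
Qed.

Section ElementCopies.
Variables (p : nat) (J : finType) (S : J -> bterm L p.+1 0)
  (xr : 'I_p -> Om -> M) (br : Om -> M) (e : R).
Hypotheses (Kx : forall i, K (xr i)) (Kb : K br).
Hypothesis far_dcl : forall th : form L p.+1, functional th ->
  pr (event th (scons br xr)) <= 1 - e.

Let G : finType := {ffun J -> bool}.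
Let pat (u : M) (v : 'I_p -> M) : G := bpat S (scons u v) (@nilv Prop).
Let Ex (s : G) (v : 'I_p -> M) := exists u, pat u v = s.
(** Where [Two s] fails, the pattern [s] determines the element from the parameters: this is how
    definable partial functions arise. *)
Let Two (s : G) (v : 'I_p -> M) :=
  exists u u', [/\ pat u v = s, pat u' v = s & u <> u'].
Let tp (v : 'I_p -> M) : {ffun G * bool -> bool} :=
  [ffun sb => `[< if sb.2 then Two sb.1 v else Ex sb.1 v >]].

Let dpat s : fdef (fun v : 'I_p.+1 -> M => bpat S v (@nilv Prop) = s).
Proof. exact: fdef_bpat. Qed.

(* Variables of [pat u v] among the variables [u', u, v]. *)
Let skip1 (i : 'I_p.+1) : 'I_p.+2 :=
  scons ord0 (fun i => lift ord0 (lift ord0 i)) i.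

Let scons_skip1 (u u' : M) (v : 'I_p -> M) :
  (fun i => scons u' (scons u v) (skip1 i)) = scons u' v.
Proof.
by apply: scons_eq => [|i]; rewrite /skip1 ?scons0 ?sconsS ?scons0 ?sconsS.
Qed.

Let dother s : fdef (fun v : 'I_p.+2 -> M =>
  bpat S (fun i => v (skip1 i)) (@nilv Prop) = s /\ v ord0 <> v (lift ord0 ord0)).
Proof.
apply: fdef_and; first exact: (fdef_ren skip1 (dpat s)).
exact/fdef_not/fdef_eq.
Qed.

Let dEx s : fdef (Ex s).
Proof. exact: (fdef_ex (dpat s)). Qed.

Let dTwo s : fdef (Two s).
Proof.
have := fdef_ex (fdef_and (dpat s) (fdef_ex (dother s))).
apply: fdef_ext => v; split.
  move=> [u [h1 [u' [h2 h3]]]]; exists u, u'.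
  move: h2 h3; rewrite scons_skip1 scons0 sconsS scons0 => h2 h3.
  by split => // uu; apply: h3.
move=> [u [u' [h1 h2 h3]]]; exists u; split => //; exists u'.
by rewrite scons_skip1 scons0 sconsS scons0; split => // uu; apply: h3.
Qed.

Let dtp t : fdef (fun v => tp v = t).
Proof.
apply: (@fdef_ffun L M p _ (fun sb v => if sb.2 then Two sb.1 v else Ex sb.1 v)).
by move=> [s []]; [exact: dTwo|exact: dEx].
Qed.

Let at_x w := fun i => xr i w.
Let F w := tp (at_x w).
Let q0 w := pat (br w) (at_x w).

Let mF : fmeas F.
Proof. by move=> t; exact: (measurable_fdef Kx (dtp t)). Qed.

Let mpat b : K b -> fmeas (fun w => pat (b w) (at_x w)).
Proof.
move=> Kb' s; have := measurable_fdef (K_scons Kb' Kx) (dpat s).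
by congr measurable; apply/seteqP; split => w /=; rewrite at_scons.
Qed.

(* On a fibre of [F], the label [(s, b)] prescribes the pattern [s], and picks
   one of two distinct realizations of [s] when these exist. *)
Let W (t : {ffun G * bool -> bool}) (l : G * bool) : R :=
  pr (F @^-1` [set t] `&` q0 @^-1` [set l.1]) *
    (if t (l.1, true) then 2^-1 else (~~ l.2)%:R).

Let W_ge0 t l : 0 <= W t l.
Proof. by rewrite mulr_ge0 ?pr_ge0//; case: ifP => // _; rewrite ?invr_ge0 ?ler0n. Qed.

Let W_pattern t s : \sum_(b : bool) W t (s, b) =
  pr (F @^-1` [set t] `&` q0 @^-1` [set s]).
Proof. by rewrite big_bool /W /= -mulrDr; case: ifP => _; lra. Qed.

Let W_fibre t : \sum_l W t l = pr (F @^-1` [set t]).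
Proof.
rewrite -(pr_joint_sum P t mF (mpat Kb)) -(pair_bigA _ (fun s b => W t (s, b)))/=.
by apply: eq_bigr => s _; exact: W_pattern.
Qed.

(** Guesses of a pattern with at most one realization define a partial function of the parameters,
    so by [far_dcl] they are right with probability at most [1 - e]; for the other patterns the fair
    bit halves the weight. The sum is at most [1 / 2 + (1 - e) / 2]. *)
Let W_le (c : {ffun G * bool -> bool} -> G * bool) :
  \sum_t W t (c t) <= 1 - e / 2.
Proof.
pose good (t : {ffun G * bool -> bool}) := ~~ t ((c t).1, true).
have [th thP] : fdef (fun v : 'I_p.+1 -> M =>
    (fun t (v : 'I_p.+1 -> M) => good t /\ bpat S v (@nilv Prop) = (c t).1)
      (tp (fun i => v (lift ord0 i))) v).
  apply: (@fdef_bigcup L M p.+1 _ (fun v => tp (fun i => v (lift ord0 i)))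
    (fun t v => good t /\ bpat S v (@nilv Prop) = (c t).1)) => t.
    exact: (fdef_ren (lift ord0) (dtp t)).
  by apply: fdef_and (dpat _); exact: fdef_const.
have lift_scons a (v : 'I_p -> M) : (fun i => scons a v (lift ord0 i)) = v.
  by apply/funext => i; rewrite sconsS.
have fth : functional th.
  move=> v a b; rewrite !thP !lift_scons => -[gt pa] [_ pb].
  apply: contrapT => ab; move: gt; rewrite /good ffunE /= => /asboolPn; apply.
  by exists a, b.
have := far_dcl fth.
pose a t := pr (F @^-1` [set t] `&` q0 @^-1` [set (c t).1]).
have a_le t : a t <= pr (F @^-1` [set t]).
  apply: prS; [apply: measurableI; [exact: mF|exact: (mpat Kb)]|exact: mF|].
  exact: subIsetl.
have a_sum : \sum_t a t <= 1.
  apply: le_trans (ler_sum _ (fun t _ => a_le t)) _.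
  have := pr_sum P mF measurableT; rewrite prT => ->.
  by apply: ler_sum => t _; rewrite setTI.
have -> : pr (event th (scons br xr)) = \sum_t (if good t then a t else 0).
  have mth : measurable (event th (scons br xr)).
    by apply: (ps_meas psP); exact: K_scons.
  rewrite (pr_sum P mF mth); apply: eq_bigr => t _.
  case: ifPn => gt.
    congr pr; apply/seteqP; split => w /=; rewrite /event /= at_scons thP lift_scons.
      by move=> [[_ h] Ft]; split => //; rewrite -Ft.
    by move=> [Ft h]; split => //; rewrite -/(F w) Ft.
  rewrite -(pr0 P); congr pr; apply/seteqP; split => w //=.
  rewrite /event /= at_scons thP lift_scons -/(F w) => -[[h _] Ft].
  by move: h; rewrite Ft (negbTE gt).
move=> th_le.
have : \sum_t W t (c t) <=
    2^-1 * \sum_t a t + 2^-1 * \sum_t (if good t then a t else 0).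
  rewrite !mulr_sumr -big_split /=; apply: ler_sum => t _.
  have := pr_ge0 P (F @^-1` [set t] `&` q0 @^-1` [set (c t).1]).
  rewrite /W /good /a; case: ifP => _ /= h; first by lra.
  by case: (c t).2 => /=; lra.
lra.
Qed.

(** The pattern can be realized, and in two ways if the bit calls for the second realization. *)
Let valid_label (t : {ffun G * bool -> bool}) (l : G * bool) :=
  t (l.1, false) && (l.2 ==> t (l.1, true)).

Let W_invalid t l : ~~ valid_label t l -> W t l = 0.
Proof.
case: l => s b; rewrite negb_and => /orP[ns|]; rewrite /W /=.
  rewrite (_ : _ `&` _ = set0) ?pr0 ?mul0r//.
  apply/seteqP; split => w //= [Ft qs]; move: ns; rewrite -Ft ffunE /=.
  by move=> /asboolPn; apply; exists (br w).
by case: b => //= /negbTE ->; rewrite mulr0.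
Qed.

(** Labels are drawn independently given [F] and realized by [u1] or [u2]. Off a null set different
    labels give different elements: either the patterns differ, or only the bits do, and [u2] avoids
    [u1]. Summing out the bit gives back the law of the pattern. *)
Lemma element_copies : exists b : nat -> Om -> M, [/\ forall n, K (b n),
  forall n j, pr [set w | bsem (scons (b n w) (at_x w)) (@nilv Prop) (S j)] =
    pr [set w | bsem (scons (br w) (at_x w)) (@nilv Prop) (S j)]
  & forall m n, (m < n)%N -> e / 2 <= pr [set w | b n w <> b m w]].
Proof.
have [q [mq qW qsep]] := independent_copies (ps_atomless psP) mF W_ge0 W_fibre W_le.
have /choice[u1 u1P] : forall s : G, exists u, K u /\
    forall w, Ex s (at_x w) -> pat (u w) (at_x w) = s.
  by move=> s; have [u Ku h] := witness Kx (dpat s); exists u.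
have /choice[u2 u2P] : forall s : G, exists u, K u /\
    forall w, Two s (at_x w) -> pat (u w) (at_x w) = s /\ u w <> u1 s w.
  move=> s; have [K1 h1] := u1P s.
  have [u Ku h] := witness (K_scons K1 Kx) (dother s); exists u; split => // w.
  move=> [a [a' [pa pa' aa']]].
  have := h w; rewrite at_scons scons_skip1 scons0 sconsS scons0; apply.
  (* Of two distinct realizations, at least one differs from [u1 s w]. *)
  have [au|au] := pselect (a = u1 s w).
    exists a'; rewrite scons_skip1 scons0 sconsS scons0; split => // ua.
    by apply: aa'; rewrite au ua.
  by exists a; rewrite scons_skip1 scons0 sconsS scons0.
pose un (l : G * bool) := if l.2 then u2 l.1 else u1 l.1.
have Kun l : K (un l).
  by rewrite /un; case: ifP => _; [have [] := u2P l.1|have [] := u1P l.1].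
pose b n w := un (q n w) w.
have Kbn n : K (b n) by exact: glue.
pose E n := [set w | ~~ valid_label (F w) (q n w)].
have mFq n := fmeas_pair mF (mq n).
have mE n : measurable (E n).
  exact: (fmeas_set [set z : {ffun G * bool -> bool} * (G * bool) |
    ~~ valid_label z.1 z.2] (mFq n)).
have pre (H : finType) (g : Om -> H) t l : (fun w => (F w, g w)) @^-1` [set (t, l)] =
    F @^-1` [set t] `&` g @^-1` [set l].
  by apply/seteqP; split => w /= [-> ->].
have E0 n : pr (E n) = 0.
  have -> := pr_sum_in P [pred z : {ffun G * bool -> bool} * (G * bool) |
    ~~ valid_label z.1 z.2] (mFq n).
  by apply: big1 => -[t l] /= tl; rewrite pre qW; exact: W_invalid.
have b_label n w : ~ E n w -> pat (b n w) (at_x w) = (q n w).1 /\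
    ((q n w).2 -> b n w <> u1 (q n w).1 w) /\
    (~~ (q n w).2 -> b n w = u1 (q n w).1 w).
  move=> /negP; rewrite negbK => /andP[]; rewrite /b /un.
  case: (q n w) => s [] /=; rewrite !ffunE /=.
    by move=> _ /asboolP h; have [_ /(_ w h)[]] := u2P s.
  by move=> /asboolP h _; have [_ /(_ w h)] := u1P s.
exists b; split => // [n j|m n mn].
  pose p1 w := pat (b n w) (at_x w).
  have mp1 : fmeas p1 by exact: mpat.
  have law s : pr (p1 @^-1` [set s]) = pr (q0 @^-1` [set s]).
    rewrite (@pr_eq_off_null _ _ _ P _ ((fun w => (q n w).1) @^-1` [set s]) (E n))//.
    - have mq1 := fmeas_comp fst (mq n).
      rewrite (pr_sum P mF (mq1 s)) (pr_sum P mF (mpat Kb s)).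
      apply: eq_bigr => t _; rewrite [in RHS]setIC -W_pattern.
      rewrite (pr_sum P (fmeas_comp snd (mq n))); last first.
        by apply: measurableI; [exact: mq1|exact: mF].
      apply: eq_bigr => c _; rewrite -(qW n t (s, c)); congr pr.
      apply/seteqP; split => w /=; first by case: (q n w) => s' c' /= [[-> ->] ->].
      by move=> [-> ->].
    - exact: (fmeas_comp fst (mq n)).
    - by move=> w /b_label[h _] /=; rewrite /p1 h.
  have := pr_same_law [pred s : G | s j] mp1 (mpat Kb) law.
  by congr (pr _ = pr _); apply/seteqP; split => w /=; rewrite inE /= ffunE => /asboolP.
have mne := measurable_neq (Kbn n) (Kbn m).
have meq : measurable [set w | q n w = q m w].
  exact: (fmeas_set [set z : (G * bool) * (G * bool) | z.1 = z.2]
    (fmeas_pair (mq n) (mq m))).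
have sub : ~` [set w | q n w = q m w] `<=`
    [set w | b n w <> b m w] `|` (E n `|` E m).
  move=> w /= nq; have [?|nEn] := pselect (E n w); first by right; left.
  have [?|nEm] := pselect (E m w); first by right; right.
  left => bb; have [hn [hn1 hn0]] := b_label n w nEn.
  have [hm [hm1 hm0]] := b_label m w nEm.
  move: hn hn1 hn0 hm hm1 hm0 nq; rewrite bb.
  case: (q n w) => s c; case: (q m w) => s' c' /= -> h1 h0 <- h1' h0'.
  by case: c h1 h0 => h1 h0; case: c' h1' h0' => h1' h0' //= _;
    [have := h0' isT; have := h1 isT|have := h0 isT; have := h1' isT].
have mEE : measurable (E n `|` E m) by exact: measurableU.
have := prS P (measurableC meq) (measurableU _ _ mne mEE) sub.
have := prU_le P mne mEE; have := prU_le P (mE n) (mE m); rewrite !E0.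
have := qsep _ _ mn; rewrite -setTD prD// prT; lra.
Qed.

End ElementCopies.

Lemma aclK_dcl_closure (X : set (KS N)) : aclK X `<=` dcl_closure X.
Proof.
move=> b0 [C [cC Cb [f fX fC]]] e e0; apply: contrapT => far_dcl.
(* The copies are only known to be [e / 2] apart, and [8 * (e / 32) < e / 2]. *)
have e320 : 0 < e / 32 by lra.
have [k0 /(_ k0 (leqnn _)) {}fC] := fC _ e320.
case: (f k0) (fX k0) fC => p [|q] psi px py [/= Xp py0] /= fC; last first.
  by have := py0 ord0.
clear py0; have [J [S SP]] := cval_determined psi e320.
have [xr Kx xrE] := K_lift px; move/funext in xrE.
have [br Kb bE] := q_surjK qP b0.
have far th : functional th -> pr (event th (scons br xr)) <= 1 - e.
  move=> fth; rewrite leNgt; apply/negP => lt; apply: far_dcl.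
  exists p, th, px; split => //; rewrite -xrE -bE -q_scons rmu_ev_not.
    by move: lt; lra.
  exact: K_scons.
have [b [Kbn law sep]] := @element_copies p J S xr br e Kx Kb far.
pose y0 : 'I_0 -> BS N := @nilv (BS N).
pose g u := cval psi (fcat (fun _ : 'I_1 => u) px) (fcat y0 py).
apply: (@compact_definable_not_separated R _ C g b0 (fun n => qK (b n))
  (e / 32) (e / 2)) => //.
- by lra.
- by move=> u; exact: (fC (fun=> u) y0).
- move=> n; apply: SP => j.
  have key a : K a -> rmu (bval (fcat (fun _ : 'I_1 => qK a) px) (fcat y0 py) (S j)) =
      pr [set w | bsem (scons (a w) (fun i => xr i w)) (@nilv Prop) (S j)].
    move=> Ka; rewrite fcat_scons -xrE -q_scons.
    have [yr my /funext <-] := B_lift (fcat y0 py).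
    rewrite (@rmu_bval p.+1 0 (scons a xr) yr (K_scons Ka Kx) my (S j)).
    congr pr; apply/seteqP; split => w /=; rewrite at_scons;
      by rewrite (_ : (fun j => yr j w) = @nilv Prop)//; apply/funext => -[].
  by rewrite -bE !key// law.
- by move=> m n mn; rewrite mdist_qK//; exact: sep.
Qed.

Lemma aclBE (X : set (KS N)) : aclB X = ev_closure X.
Proof.
by apply/seteqP; split; [exact: aclB_ev_closure|exact: ev_closure_aclB].
Qed.

Lemma aclKE (X : set (KS N)) : aclK X = dcl_closure X.
Proof.
by apply/seteqP; split; [exact: aclK_dcl_closure|exact: dcl_closure_aclK].
Qed.

Lemma ev_closure_mono (X X' : set (KS N)) : X `<=` X' ->
  ev_closure X `<=` ev_closure X'.
Proof.
move=> XX E EX e /EX[n [phi [x [Xx h]]]]; exists n, phi, x.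
by split => // i; exact: XX.
Qed.

Lemma dcl_closure_mono (X X' : set (KS N)) : X `<=` X' ->
  dcl_closure X `<=` dcl_closure X'.
Proof.
move=> XX b bX e /bX[n [th [x [fth Xx h]]]]; exists n, th, x.
by split => // i; exact: XX.
Qed.

(** * Local character *)

(** [d0] is the value of [th] at [x] where there is one, and arbitrary elsewhere, where [th(b, x)]
    fails anyway. It is chosen before [th] is known to be functional, so that it becomes a total
    function of [th] and [x]. *)
Lemma functional_realizer n (th : form L n.+1) (x : 'I_n -> KS N) :
  exists d0, functional th -> forall b,
    mdist b d0 <= rmu (ev (FNot th) (scons b x)).
Proof.
have [xr Kx <-] : exists2 xr, forall i, K (xr i) & (fun i => qK (xr i)) = x.
  by have [xr Kx /funext h] := K_lift x; exists xr.
have [u Ku uP] := witness Kx (fdef_sat M th).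
exists (qK u) => fth b; have [br Kb <-] := q_surjK qP b.
have Kbx := K_scons Kb Kx.
rewrite mdist_qK// -q_scons rmu_ev//.
apply: prS; [exact: measurable_neq|exact: (ps_meas psP)|].
move=> w /= bu; rewrite /event /= at_scons => h; apply: bu.
by apply: (fth _ _ _ h); apply: uP; exists (br w).
Qed.

Lemma tuple_seq (X : Type) (x0 : X) n (x : 'I_n -> X) :
  exists s : seq X, size s = n /\ (fun i : 'I_n => nth x0 s i) = x.
Proof.
exists [seq x i | i <- enum 'I_n]; rewrite size_map size_enum_ord; split => //.
by apply/funext => i; rewrite (nth_map i) ?size_enum_ord// nth_ord_enum.
Qed.

Lemma allin_tuple (X : Type) (x0 : X) (D : set X) n (x : 'I_n -> X) (s : seq X) :
  size s = n -> (fun i : 'I_n => nth x0 s i) = x -> (forall i, D (x i)) ->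
  allin x0 D s.
Proof.
by move=> sz <- Dx k ks; rewrite sz in ks; exact: (Dx (Ordinal ks)).
Qed.

Lemma alg_indep_local (A B C0 : set (KS N)) :
  countable_language L -> C0 `<=` B -> (C0 #<= plus_aleph0 A)%card ->
  exists C : set (KS N),
    [/\ C0 `<=` C, C `<=` B, (C #<= plus_aleph0 A)%card & alg_indep A C B].
Proof.
move=> cL C0B C0A; have [k0 _] := K_nonempty; pose x0 := qK k0.
pose vec n (s : seq (KS N)) := fun i : 'I_n => nth x0 s i.
pose wit n (th : form L n.+1) x := projT1 (cid (functional_realizer th x)).
have witP n (th : form L n.+1) x : functional th -> forall b,
    mdist b (wit n th x) <= rmu (ev (FNot th) (scons b x)).
  exact: (projT2 (cid (functional_realizer th x))).
(* An index consists of the formula to be approximated, the precision and the sort, [true] for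
   elements and [false] for events. The approximating formula is left existential in [good]. *)
pose I := ({l : nat & form L l} * nat * bool)%type.
have cI : countable [set: I].
  have /countable_injP[f fi] := countable_forms cL.
  apply/countable_injP; exists (fun i : I => choice.pickle (f i.1.1, i.1.2, i.2)).
  move=> [[c k] b] [[c' k'] b'] _ _ /(pcan_inj choice.pickleK)[/fi + -> ->].
  by rewrite !inE => ->.
(* The formula of a partial function needs a variable for the value; one without variables gets the
   default [x0]. *)
pose witc (c : {l : nat & form L l}) (s : seq (KS N)) : KS N :=
  match c with
  | existT 0 _ => x0
  | existT n.+1 th => wit n th (vec n s)
  end.
pose good (i : I) (s r : seq (KS N)) : Prop :=
  if i.2 then exists n (th : form L n.+1), [/\ functional th, size r = n
      & rmu (ev (FNot th) (scons (witc i.1.1 s) (vec n r))) <= i.1.2.+1%:R^-1]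
  else exists n (psi : form L n), size r = n /\
    mdist (ev (tagged i.1.1) (vec (tag i.1.1) s)) (ev psi (vec n r)) <=
      i.1.2.+1%:R^-1.
have [C [C0C CB CA Cgood]] := skolem_closure x0 good cI C0B C0A.
have invec n (D : set (KS N)) r : size r = n -> allin x0 D r ->
    forall i, D (vec n r i).
  by move=> sz Dr i; apply: Dr; rewrite sz.
exists C; split => //; rewrite /alg_indep (setUidl CB) !aclKE !aclBE.
(* The approximations over [A] and [C] and over [B] are taken up to [t / 2], so they are within [t]
   of each other; after passing to parameters in [C] the error is at most [t + t / 2], less than
   [e]. *)
have half (e : R) : 0 < e -> exists (k : nat) (t : R),
    [/\ k.+1%:R^-1 = t, 0 < t / 2 & t <= e / 2].
  move=> e0; have e20 : 0 < e / 2 by lra.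
  have [k /(_ k (leqnn _)) ke] := inv_succ_le e20.
  by exists k, k.+1%:R^-1; rewrite divr_gt0 ?invr_gt0.
split; apply/seteqP; split.
- move=> b [bAC bB] e /half[k [t [kt k2 ke]]].
  have [n [th [x [fth ACx bx]]]] := bAC _ k2.
  have [n' [th' [x' [fth' Bx' bx']]]] := bB _ k2.
  have [s [sz svec]] := tuple_seq x0 x; have [s' [sz' svec']] := tuple_seq x0 x'.
  have bd := le_trans (witP _ th x fth b) bx.
  have wE : witc (existT (form L) n.+1 th) s = wit n th x by rewrite /= /vec svec.
  have [||r [Cr [m [ps [fps szr]]]]] := Cgood (existT (form L) n.+1 th, k, true) s.
  + exact: (allin_tuple sz svec).
  + exists s'; split; first exact: (allin_tuple sz' svec').
    exists n', th'; split => //; rewrite wE /vec svec' /= kt.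
    have /ler_normlP[_] := functional_dist x' (wit n th x) b fth'.
    rewrite (metric_sym (wit n th x)) => h; move: h bd bx'.
    set X1 := rmu _; set X2 := rmu _; set X3 := mdist _ _; lra.
  rewrite wE /= kt => h; exists m, ps, (vec m r); split => //; first exact: invec.
  have /ler_normlP[_] := functional_dist (vec m r) b (wit n th x) fps.
  move: h bd ke; set X1 := rmu _; set X2 := mdist _ _; set X3 := rmu _; lra.
- by move=> b bC; split; apply: dcl_closure_mono bC => // x; right.
- move=> E [EAC EB] e /half[k [t [kt k2 ke]]].
  have [n [phi [x [ACx Ex]]]] := EAC _ k2.
  have [n' [psi [x' [Bx' Ex']]]] := EB _ k2.
  have [s [sz svec]] := tuple_seq x0 x; have [s' [sz' svec']] := tuple_seq x0 x'.
  have [||r [Cr [m [ps [szr]]]]] := Cgood (existT (form L) n phi, k, false) s.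
  + exact: (allin_tuple sz svec).
  + exists s'; split; first exact: (allin_tuple sz' svec').
    exists n', psi; split => //; rewrite /vec svec' /= svec kt.
    have := metric_triangle (ev phi x) E (ev psi x').
    rewrite (metric_sym (ev phi x) E) => h; move: h Ex Ex'.
    set X1 := mdist _ _; set X2 := mdist _ _; set X3 := mdist _ _; lra.
  rewrite /= /vec svec kt => h; exists m, ps, (vec m r); split; first exact: invec.
  have := metric_triangle E (ev phi x) (ev ps (vec m r)).
  move: h Ex ke; rewrite -/(vec m r).
  set X1 := mdist _ _; set X2 := mdist _ _; set X3 := mdist _ _; lra.
- by move=> E EC; split; apply: ev_closure_mono EC => // x; right.
Qed.

End Randomization.

Theorem theorem6p9 (R : realType) (U : Type) (L : language) (T : theory L)
    (M : structure L) (d : measure_display) (Omega : measurableType d)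
    (P : probability Omega R) (K : set (Omega -> M)) (N : rstructure L R) :
  uncountable_inaccessible U ->
  countable_language L ->
  complete_theory T ->
  (forall M' : structure L, models M' T -> exists a b : M', a <> b) ->
  has_acl_eq_dcl T ->
  big_model U T M ->
  is_prestructure P K ->
  big_model_TR U T N ->
  is_reduction P K N ->
  small_local_character U (@alg_indep L R N).
Proof.
move=> _ cL _ _ _ _ psP [trP _ _] [qK [qB qP]] A B C0 _ _ _ C0B C0A.
exact: (alg_indep_local psP qP trP cL C0B C0A).
Qed.
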